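(* Let $n\ge 1$, $m\ge 0$ and $s$ be integers with $1\le s\le n$. Consider the hexagon $H$ in the triangular lattice (unit equilateral triangles, with one family of lattice lines vertical) whose sides have lengths $n,n,2m+1,n,n,2m+1$ in cyclic order, the two sides of length $2m+1$ being vertical. Let $L$ be the horizontal symmetry axis of $H$ (the line through the midpoints of the two vertical sides); $L$ contains exactly $n$ lattice vertices in the interior of $H$, numbered $1,\dots,n$ from left to right. Let $P$ be the $s$-th of these vertices, and remove from $H$ the two unit triangles that have $P$ as a vertex and are bisected by $L$ (one immediately to the left and one immediately to the right of $P$, touching only at $P$). Then the number of rhombus tilings of the resulting region equals $$\frac{(2m+1)\binom{2m}{m}\binom{2n-2s}{n-s}\binom{2s-2}{s-1}}{\binom{2m+2n}{m+n}}\prod_{i=1}^{n}\prod_{j=1}^{n}\prod_{k=1}^{2m+1}\frac{i+j+k-1}{i+j+k-2}.$$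
   Context: A rhombus tiling of a region made of unit triangles of the triangular lattice is a tiling of the region by unit rhombi, each rhombus being the union of two unit equilateral triangles sharing a side. *)

(* Defs.v *)
From mathcomp Require Import all_boot all_order all_algebra.
From mathcomp Require Import finmap zify.

Set Implicit Arguments.
Unset Strict Implicit.
Unset Printing Implicit Defensive.

Import Order.TTheory GRing.Theory Num.Theory.

Local Open Scope ring_scope.

(* The vertex (a, b) of the triangular lattice is the point of the plane      *)
(* a * (sqrt 3 / 2, 1 / 2) + b * (0, 1): a indexes the vertical lattice line  *)
(* and b + a / 2 is the height on it.                                         *)
Notation point := (int * int)%type.

(* ((a, b), false) and ((a, b), true) are the two halves of the unit          *)
(* parallelogram with lowest-left vertex (a, b), cut along the segment from   *)
(* (a + 1, b) to (a, b + 1); the first one points right, the second one left. *)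
Notation triangle := (point * bool)%type.

Definition vertices (t : triangle) : seq point :=
  let: ((a, b), d) := t in
  if d then [:: (a, b + 1); (a + 1, b); (a + 1, b + 1)]
  else [:: (a, b); (a, b + 1); (a + 1, b)].

Definition share_side (t u : triangle) : bool :=
  size [seq v <- vertices t | v \in vertices u] == 2.

Definition is_rhombus (D : {fset triangle}) (B : {set D}) : bool :=
  [exists t : D, exists u : D, (B == [set t; u]) && share_side (val t) (val u)].

Definition rhombus_tilings (D : {fset triangle}) : {set {set {set D}}} :=
  [set T : {set {set D}} |
    partition T [set: D] && [forall B in T, is_rhombus B]].

(* The origin is the lower end of the left vertical side of H. Its other      *)
(* corners are, counterclockwise, (n, -n), (2n, -n), (2n, 2m+1-n), (n, 2m+1)  *)
(* and (0, 2m+1).                                                             *)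
Definition in_H (n m : nat) (p : point) : bool :=
  [&& 0 <= p.1 <= (2 * n)%:Z, - n%:Z <= p.2 <= (2 * m + 1)%:Z
    & 0 <= p.1 + p.2 <= (n + 2 * m + 1)%:Z].

Definition in_interior_H (n m : nat) (p : point) : bool :=
  [&& 0 < p.1 < (2 * n)%:Z, - n%:Z < p.2 < (2 * m + 1)%:Z
    & 0 < p.1 + p.2 < (n + 2 * m + 1)%:Z].

Definition hexagon (n m : nat) : {fset triangle} :=
  [fset t in [seq (p, d) | p <- [seq (i%:Z, j%:Z - n%:Z) |
                  i <- iota 0 (2 * n), j <- iota 0 (n + 2 * m + 1)],
                d <- [:: false; true]]
    | all (in_H n m) (vertices t)]%fset.

(* The enumeration in hexagon misses nothing.                                 *)
Lemma in_hexagon (n m : nat) (t : triangle) :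
  (t \in hexagon n m) = all (in_H n m) (vertices t).
Proof.
rewrite !inE; apply: andb_idl; case: t => [[a b] d] H.
have [ha hb] : 0 <= a < (2 * n)%:Z /\ - n%:Z <= b < (2 * m + 1)%:Z.
  by case: d H => /=; rewrite /in_H /=; lia.
apply/allpairsP; exists ((a, b), d); split=> //=; last by case: (d).
apply/allpairsP; exists (absz a, absz (b + n%:Z)%R); rewrite !mem_iota /=.
by split; [lia | lia | congr pair; lia].
Qed.

(* Reflection in L, the line of height m + 1/2.                               *)
Definition reflect_L (m : nat) (p : point) : point :=
  (p.1, (2 * m + 1)%:Z - p.1 - p.2).

Definition on_L (m : nat) (p : point) : bool := reflect_L m p == p.

Definition bisected_by_L (m : nat) (t : triangle) : bool :=
  perm_eq (map (reflect_L m) (vertices t)) (vertices t).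

Definition axis_vertex (m s : nat) : point :=
  (s%:Z *+ 2 - 1, m%:Z + 1 - s%:Z).

(* The vertices of L interior to H, numbered 1, ..., n from left to right.    *)
Lemma axis_vertexP (n m : nat) (p : point) :
  in_interior_H n m p && on_L m p <->
  exists2 s : nat, (1 <= s <= n)%N & p = axis_vertex m s.
Proof.
case: p => a b; rewrite /in_interior_H /on_L /reflect_L /axis_vertex /=.
split=> [/andP[H /eqP[E]]|[s hs [-> ->]]].
  exists (absz (m%:Z + 1 - b)%R); first by lia.
  by congr pair; lia.
by rewrite xpair_eqE eqxx; lia.
Qed.

Lemma axis_vertex_left_to_right (m s s' : nat) :
  ((axis_vertex m s).1 < (axis_vertex m s').1) = (s < s')%N.
Proof. by rewrite /axis_vertex /=; lia. Qed.

Definition removed (m s : nat) (t : triangle) : bool :=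
  (axis_vertex m s \in vertices t) && bisected_by_L m t.

Lemma removedE (m s : nat) (t : triangle) :
  removed m s t =
  (t \in [:: ((s%:Z *+ 2 - 2, m%:Z + 1 - s%:Z), false);
             ((s%:Z *+ 2 - 1, m%:Z - s%:Z), true)]).
Proof.
rewrite /removed; case: t => [[a b] d].
have -> : bisected_by_L m ((a, b), d) = (a + b *+ 2 + d%:Z == (2 * m)%:Z).
  apply/idP/eqP.
    case: d => /perm_mem H.
      have := H (a, b + 1); rewrite !inE /= /reflect_L /= !xpair_eqE; lia.
    have := H (a + 1, b); rewrite !inE /= /reflect_L /= !xpair_eqE; lia.
  move=> E; rewrite /bisected_by_L /reflect_L; case: d E => /= E.
    have -> : (2 * m + 1)%:Z - a - (b + 1) = b + 1 by lia.
    have -> : (2 * m + 1)%:Z - (a + 1) - b = b + 1 by lia.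
    have -> : (2 * m + 1)%:Z - (a + 1) - (b + 1) = b by lia.
    by rewrite perm_cons; apply/permP => f /=; lia.
  have -> : (2 * m + 1)%:Z - a - b = b + 1 by lia.
  have -> : (2 * m + 1)%:Z - a - (b + 1) = b by lia.
  have -> : (2 * m + 1)%:Z - (a + 1) - b = b by lia.
  by apply/permP => f /=; lia.
by case: d; rewrite /axis_vertex /vertices !inE !xpair_eqE /=; lia.
Qed.

Definition holed_hexagon (n m s : nat) : {fset triangle} :=
  [fset t in hexagon n m | ~~ removed m s t]%fset.

(* Main.v *)
(** The triangle ((a, b), false) touches ((a, b), true), ((a, b - 1), true) and
((a - 1, b), true), so a tiling is a perfect matching, a term of the determinant
of the bipartite adjacency matrix K.  In the holed hexagon all matchings have
the same sign (count inversions for the lexicographic order), so the number of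
tilings is |det| of a minor of K, and by Cramer's rule it is |det K| times the
value at the removed left-pointing triangle of the solution of K f = e, with e
the indicator of the removed right-pointing one.

Up to the sign (-1)^(a+b), the equations K f = e express each column of f as the
backward difference of the next one, with a source at the hole.  Everything thus
depends only on the last column y, whose 2n-th difference is prescribed, and
which is centred on L.  With N = 2m+1:
- |det K| is found by induction on N: for the source and target at the two ends
  of the top strip the remaining strip is forced, so the minor is the matrix of
  the hexagon with N - 1, and y is a polynomial of degree 2n - 1 with prescribed
  zeros.
- For the hole, y solves E^n y = E^(s-1) delta_0 on [-m, m], where E is the
  second central difference, and the ratio is E^(n-s) y (0).  Going from m - 1 to
  m adds to y a multiple of the polynomial prod_{0<t<n} ((m+t)^2 - k^2), cut off
  at |k| <= m; its central differences at 0 are explicit products, and the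
  increments of the ratio telescope. *)

Require Import Defs.
From mathcomp Require Import all_boot all_order all_algebra.
From mathcomp Require Import fingroup perm finmap zify ring lra.

Set Implicit Arguments.
Unset Strict Implicit.
Unset Printing Implicit Defensive.

Import Order.TTheory GRing.Theory Num.Theory.

Local Open Scope ring_scope.

(** * Differences of functions on the integers *)

Definition bdiff (F : int -> rat) (k : int) : rat := F k - F (k - 1).
Definition cdiff (F : int -> rat) (k : int) : rat := F (k + 1) - F k *+ 2 + F (k - 1).

Lemma eq_bdiff F G : F =1 G -> bdiff F =1 bdiff G.
Proof. by move=> e k; rewrite /bdiff !e. Qed.

Lemma eq_cdiff F G : F =1 G -> cdiff F =1 cdiff G.
Proof. by move=> e k; rewrite /cdiff !e. Qed.

Lemma eq_iter_bdiff a F G : F =1 G -> iter a bdiff F =1 iter a bdiff G.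
Proof. by move=> e; elim: a => //= a IH; apply: eq_bdiff. Qed.

Lemma eq_iter_cdiff a F G : F =1 G -> iter a cdiff F =1 iter a cdiff G.
Proof. by move=> e; elim: a => //= a IH; apply: eq_cdiff. Qed.

Lemma iter_bdiff_even a F (k : int) :
  iter (2 * a) bdiff F (k + a%:Z) = iter a cdiff F k.
Proof.
elim: a k => [|a IH] k; first by rewrite addr0.
have -> : (2 * a.+1)%N = (2 * a).+2 by lia.
rewrite !iterS {1}/bdiff /bdiff /cdiff -!IH.
have -> : k + a.+1%:Z = k + 1 + a%:Z by lia.
have -> : k + 1 + a%:Z - 1 = k + a%:Z by lia.
have -> : k + a%:Z - 1 = k - 1 + a%:Z by lia.
by ring.
Qed.

Lemma iter_bdiff_mul a F (k : int) :
  iter a.+1 bdiff (fun j => j%:~R * F j) k =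
    k%:~R * iter a.+1 bdiff F k + a.+1%:R * iter a bdiff F (k - 1).
Proof.
elim: a k => [|a IH] k; first by rewrite /= /bdiff !rmorphB /=; ring.
rewrite iterS {1}/bdiff !IH /= {1 3 5}/bdiff !rmorphB /= -[a.+2]addn1 -[a.+1]addn1 !natrD.
rewrite /bdiff; ring.
Qed.

Lemma iter_cdiff_sqr a F (k : int) :
  iter a.+1 cdiff (fun j => j%:~R ^+ 2 * F j) k =
    k%:~R ^+ 2 * iter a.+1 cdiff F k
    + 2 * a.+1%:R * k%:~R * (iter a cdiff F (k + 1) - iter a cdiff F (k - 1))
    + a.+1%:R * (iter a.+1 cdiff F k + 2 * iter a cdiff F k)
    + (a.+1 * a)%:R * (iter a.+1 cdiff F k + 4 * iter a cdiff F k).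
Proof.
elim: a k => [|a IH] k.
  by rewrite /= /cdiff !rmorphB !rmorphD /=; ring.
rewrite iterS {1}/cdiff !IH [iter a.+2 _ _]iterS ![iter a.+1 _ _]iterS.
move: (iter a cdiff F) => G; rewrite /cdiff !rmorphB !rmorphD /= !natrM.
rewrite ?addrK ?subrK -[a.+2]addn1 -[a.+1]addn1 !natrD.
ring.
Qed.

Lemma iter_cdiff_sqr0 a F :
  iter a.+1 cdiff (fun j => j%:~R ^+ 2 * F j) 0 =
    a.+1%:R ^+ 2 * iter a.+1 cdiff F 0
    + (2 * a.+1 * (2 * a + 1))%:R * iter a cdiff F 0.
Proof.
rewrite iter_cdiff_sqr !natrM natrD -[a.+1]addn1 natrD; ring.
Qed.

Lemma iter_bdiffB a F G (k : int) :
  iter a bdiff (fun j => F j - G j) k = iter a bdiff F k - iter a bdiff G k.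
Proof. by elim: a k => [|a IH] k //=; rewrite {1}/bdiff !IH /bdiff; ring. Qed.

Lemma iter_bdiffZ a c F (k : int) :
  iter a bdiff (fun j => c * F j) k = c * iter a bdiff F k.
Proof. by elim: a k => [|a IH] k //=; rewrite {1}/bdiff !IH /bdiff; ring. Qed.

Lemma iter_cdiffD a F G (k : int) :
  iter a cdiff (fun j => F j + G j) k = iter a cdiff F k + iter a cdiff G k.
Proof. by elim: a k => [|a IH] k //=; rewrite {1}/cdiff !IH /cdiff; ring. Qed.

Lemma iter_cdiffZ a c F (k : int) :
  iter a cdiff (fun j => c * F j) k = c * iter a cdiff F k.
Proof. by elim: a k => [|a IH] k //=; rewrite {1}/cdiff !IH /cdiff; ring. Qed.

Lemma iter_cdiffB a F G (k : int) :
  iter a cdiff (fun j => F j - G j) k = iter a cdiff F k - iter a cdiff G k.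
Proof. by elim: a k => [|a IH] k //=; rewrite {1}/cdiff !IH /cdiff; ring. Qed.

Definition sqprod (B p : nat) (k : int) : rat :=
  \prod_(t < p) ((B + t.+1)%:R ^+ 2 - k%:~R ^+ 2).

Lemma sqprodS B p k :
  sqprod B p.+1 k = (B + p.+1)%:R ^+ 2 * sqprod B p k - k%:~R ^+ 2 * sqprod B p k.
Proof. by rewrite /sqprod big_ord_recr /=; ring. Qed.

Lemma iter_cdiff_sqprodS B p a (k : int) :
  iter a cdiff (sqprod B p.+1) k =
  (B + p.+1)%:R ^+ 2 * iter a cdiff (sqprod B p) k -
   iter a cdiff (fun k => k%:~R ^+ 2 * sqprod B p k) k.
Proof. by rewrite -iter_cdiffZ -iter_cdiffB; apply: eq_iter_cdiff => j; rewrite sqprodS. Qed.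

Lemma iter_cdiff_sqprod_gt B p a (k : int) : (p < a)%N -> iter a cdiff (sqprod B p) k = 0.
Proof.
elim: p a k => [|p IH] a k.
  case: a => // a _; rewrite iterSr.
  have: forall j, cdiff (sqprod B 0) j = 0 by move=> j; rewrite /cdiff /sqprod !big_ord0; ring.
  by elim: a k => [|a IH] k e //=; rewrite /cdiff !IH //; ring.
case: a => // a lt_pa; rewrite iter_cdiff_sqprodS iter_cdiff_sqr.
rewrite ![iter a.+1 _ _ _]IH ?(ltnW lt_pa) // !IH //; ring.
Qed.

Ltac nonzero :=
  rewrite ?pnatr_eq0 -?lt0n ?fact_gt0 //=;
  repeat (apply/andP; split); rewrite ?pnatr_eq0 -?lt0n ?fact_gt0 //;
  apply: lt0r_neq0;
  repeat (match goal with |- context [GRing.natmul 1 ?n] => is_var n;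
    let x := fresh "x" in move: (ler0n rat n); set x := (GRing.natmul 1 n); clearbody x end);
  intros; nra.

Lemma iter_cdiff_sqprod0 B a b :
  iter a cdiff (sqprod B (a + b)) 0 =
  (-1) ^+ a * ((2 * a)`!)%:R * (((a + b)`!)%:R / (a`!%:R * b`!%:R)) *
     (((B + a + b)`!%:R * (B + b)`!%:R) / ((B + a)`!%:R * B`!%:R)).
Proof.
have fN0 q : q`!%:R != 0 :> rat by rewrite pnatr_eq0 -lt0n fact_gt0.
suff H p : forall a b, p = (a + b)%N -> iter a cdiff (sqprod B p) 0 =
  (-1) ^+ a * ((2 * a)`!)%:R * (p`!%:R / (a`!%:R * b`!%:R)) *
     (((B + p)`!%:R * (B + b)`!%:R) / ((B + a)`!%:R * B`!%:R)).
  by rewrite (H _ a b) // addnA.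
elim: p {a b} => [|p IH] a b e.
  have [-> ->] : a = 0%N /\ b = 0%N by lia.
  by rewrite /= /sqprod big_ord0 !addn0 /= fact0; field; rewrite ?fN0.
case: a e => [|a] e.
  have {e}-> : b = p.+1 by lia.
  rewrite /= sqprodS -[sqprod _ _ _]/(iter 0 cdiff (sqprod B p) 0) (IH 0%N p) //.
  rewrite ?add0n ?addn0 ?muln0 addnS !factS !natrM; field; nonzero.
rewrite iter_cdiff_sqprodS iter_cdiff_sqr0 (IH a b); last by lia.
case: b e => [|b] e.
  rewrite iter_cdiff_sqprod_gt; last by lia.
  have {e}-> : p = a by lia.
  rewrite ?addn0 mulnS ?addnS ?add2n ?factS !natrM -?natr1 ?natrD ?natrM [(-1) ^+ a.+1]exprS.
  field; nonzero.
rewrite (IH a.+1 b); last by lia.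
have {e}-> : p = (a + b).+1 by lia.
rewrite mulnS ?addnS ?addSn ?add0n ?factS !natrM -?natr1 ?natrD ?natrM [(-1) ^+ a.+1]exprS.
field; nonzero.
Qed.

Definition kdelta (p k : int) : rat := (k == p)%:R.

Lemma iter_cdiff_local a F G (k : int) :
  (forall j, `|j - k| <= a%:Z -> F j = G j) -> iter a cdiff F k = iter a cdiff G k.
Proof.
elim: a k => [|a IH] k e; first by apply: e; lia.
by rewrite !iterS /cdiff !IH // => j hj; apply: e; lia.
Qed.

Lemma iter_cdiff0 a (k : int) : iter a cdiff (fun=> 0) k = 0.
Proof. by elim: a k => //= a IH k; rewrite /cdiff !IH mul0rn addr0 subr0. Qed.

Lemma iter_cdiff_even a F : (forall k, F (- k) = F k) ->
  forall k, iter a cdiff F (- k) = iter a cdiff F k.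
Proof.
move=> e; elim: a => //= a IH k; rewrite /cdiff.
have -> : - k + 1 = - (k - 1) by lia.
have -> : - k - 1 = - (k + 1) by lia.
by rewrite !IH; ring.
Qed.

Lemma iter_cdiff_supp a F (m : nat) : (forall k, m%:Z < `|k| -> F k = 0) ->
  forall k, (m + a)%N%:Z < `|k| -> iter a cdiff F k = 0.
Proof.
move=> h k hk; rewrite -(iter_cdiff0 a k); apply: iter_cdiff_local => j hj.
by apply: h; lia.
Qed.

Lemma iter_cdiff_kdelta0 a p (k : int) : a%:Z < `|k - p| -> iter a cdiff (kdelta p) k = 0.
Proof.
move=> h; rewrite -(iter_cdiff0 a k); apply: iter_cdiff_local => j hj.
by rewrite /kdelta; case: eqP => // e; lia.
Qed.

Lemma iter_cdiff_kdelta1 a p (k : int) : `|k - p| = a%:Z -> iter a cdiff (kdelta p) k = 1.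
Proof.
elim: a k => [|a IH] k h.
  by rewrite /= /kdelta; have -> : k = p; [lia | rewrite eqxx].
rewrite iterS /cdiff (@iter_cdiff_kdelta0 a p k) ?mul0rn ?subr0; last by lia.
have [hk|hk] := leP p k.
  by rewrite iter_cdiff_kdelta0 ?add0r ?IH //; lia.
by rewrite addrC iter_cdiff_kdelta0 ?add0r ?IH //; lia.
Qed.

Lemma discrete_green X Y (s : int) N :
  \sum_(i < N) (X (s + i%:Z) * cdiff Y (s + i%:Z) - cdiff X (s + i%:Z) * Y (s + i%:Z)) =
  (X (s + N%:Z - 1) * Y (s + N%:Z) - X (s + N%:Z) * Y (s + N%:Z - 1))
  - (X (s - 1) * Y s - X s * Y (s - 1)).
Proof.
elim: N => [|N IH]; first by rewrite big_ord0 addr0 subrr.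
rewrite big_ord_recr IH /= /cdiff.
have -> : s + N.+1%:Z = s + N%:Z + 1 by lia.
rewrite addrK; ring.
Qed.

Definition symsum (M : nat) (F : int -> rat) := \sum_(i < (2 * M).+1) F (- M%:Z + i%:Z).

Lemma symsum_cdiff M X Y : (forall k, M%:Z <= `|k| -> Y k = 0) ->
  symsum M (fun k => X k * cdiff Y k) = symsum M (fun k => cdiff X k * Y k).
Proof.
move=> h; apply/eqP; rewrite -subr_eq0 /symsum -sumrB discrete_green !h; first by rewrite !mulr0 !subrr.
all: lia.
Qed.

Lemma symsum_iter_cdiff M X Y a m : (forall k, m%:Z < `|k| -> Y k = 0) -> (m + a <= M)%N ->
  symsum M (fun k => X k * iter a cdiff Y k) = symsum M (fun k => iter a cdiff X k * Y k).
Proof.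
move=> h; elim: a X => [//|a IH] X hM; rewrite [RHS](_ : _ = symsum M (fun k => iter a cdiff (cdiff X) k * Y k)).
  rewrite -IH; last by lia.
  by apply: symsum_cdiff => k hk; apply: (iter_cdiff_supp h); lia.
by apply: eq_bigr => i _; rewrite iterSr.
Qed.

Lemma symsum_kdelta M X : symsum M (fun k => X k * kdelta 0 k) = X 0.
Proof.
have hM : (M < (2 * M).+1)%N by lia.
rewrite /symsum (bigD1 (Ordinal hM)) //= big1 => [|i /eqP ne].
  by rewrite addNr /kdelta eqxx mulr1 addr0.
rewrite /kdelta; case: eqP => [e|_]; last by rewrite mulr0.
by case: ne; apply: val_inj => /=; lia.
Qed.

Lemma symsum_pair M F m : (0 < m <= M)%N -> (forall k, `|k| <= M%:Z -> `|k| != m%:Z -> F k = 0) ->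
  symsum M F = F (m%:Z) + F (- m%:Z).
Proof.
move=> hm h; have h1 : (M + m < (2 * M).+1)%N by lia.
have h2 : (M - m < (2 * M).+1)%N by lia.
rewrite /symsum (bigD1 (Ordinal h1)) //= (bigD1 (Ordinal h2)) /=; last first.
  by apply/negP => /eqP /(congr1 val) /=; lia.
rewrite big1 ?addr0 => [|i /andP[/eqP n1 /eqP n2]].
  by congr (F _ + F _); lia.
apply: h; have := ltn_ord i; first by lia.
move=> hi; apply/negP => /eqP e.
have [e1|e1] : (i = M + m :> nat \/ i = M - m :> nat)%N by lia.
  by case: n1; apply: val_inj.
by case: n2; apply: val_inj.
Qed.

Lemma sqprod_even B p (k : int) : sqprod B p (- k) = sqprod B p k.
Proof. by apply: eq_bigr => t _; rewrite rmorphN sqrrN. Qed.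

Lemma sqprod_eq0 B p (k : int) : B%:Z < `|k| -> `|k| <= (B + p)%N%:Z -> sqprod B p k = 0.
Proof.
move=> h1 h2; have h3 : (absz k - B.+1 < p)%N by lia.
apply/eqP/prodf_eq0; exists (Ordinal h3) => //=.
rewrite subr_sqr mulf_eq0 subr_eq0 addr_eq0 -rmorphN !pmulrn !eqr_int; lia.
Qed.

Lemma sqprod_base B p :
  sqprod B p B%:Z = p`!%:R * (2 * B + p)`!%:R / (2 * B)`!%:R.
Proof.
elim: p => [|p IH]; first by rewrite /sqprod big_ord0 addn0 fact0; field; nonzero.
rewrite sqprodS IH -pmulrn !addnS !factS !natrM -!natr1 !natrD ?natrM; field; nonzero.
Qed.

Lemma sqprod_above B p r :
  sqprod B p (B + p + 1 + r)%N%:Z = (-1) ^+ p * (p + r)`!%:R / r`!%:R *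
    ((2 * B + 2 * p + 1 + r)`!%:R / (2 * B + p + 1 + r)`!%:R).
Proof.
elim: p r => [|p IH] r.
  by rewrite /sqprod big_ord0 add0n muln0 !addn0; field; nonzero.
have -> : (B + p.+1 + 1 + r = B + p + 1 + r.+1)%N by lia.
rewrite sqprodS IH -pmulrn [(-1) ^+ p.+1]exprS.
have -> : (2 * B + 2 * p.+1 + 1 + r = (2 * B + 2 * p + 1 + r.+1).+1)%N by lia.
have -> : (2 * B + p.+1 + 1 + r = 2 * B + p + 1 + r.+1)%N by lia.
have -> : (p.+1 + r = p + r.+1)%N by lia.
rewrite !factS !natrM -!natr1 !natrD -?natr1 ?natrM; field; nonzero.
Qed.

(** * The difference equation on the axis *)

Lemma central_binE a : 'C(2 * a, a)%:R = (2 * a)`!%:R / (a`!%:R * a`!%:R) :> rat.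
Proof.
have h : (a <= 2 * a)%N by lia.
have := bin_fact h; have -> : (2 * a - a = a)%N by lia.
move/(congr1 (fun k => k%:R : rat)); rewrite !natrM => <-.
by field; nonzero.
Qed.

Lemma iter_cdiff_kdelta_center a : iter a cdiff (kdelta 0) 0 = (-1) ^+ a * 'C(2 * a, a)%:R.
Proof.
elim: a => [|a IH]; first by rewrite /= /kdelta eqxx muln0 bin0 mulr1.
have := iter_cdiff_sqr0 a (kdelta 0); rewrite IH.
rewrite (eq_iter_cdiff a.+1 (G := fun=> 0)) ?iter_cdiff0; last first.
  by move=> j; rewrite /kdelta; case: eqP => [->|_]; rewrite ?mulr0 // expr0n mul0r.
move: (iter a.+1 _ _ _) => x.
rewrite !central_binE mulnS !addSn !factS !natrM -!natr1 !natrD ?natrM [(-1) ^+ a.+1]exprS => e.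
have n1 : a%:R + 1 != 0 :> rat by rewrite natr1 pnatr_eq0.
apply: (mulfI (expf_neq0 2 n1)); move/esym/eqP: e; rewrite addr_eq0 => /eqP ->.
rewrite add0n; field; nonzero.
Qed.

(* a = s - 1 and b = n - s.  In the induction step, with X the polynomial
   [sqprod m.+1 (n - 1)], pairing the defect Z of the previous solution with X
   (Green's identity and E^n X = 0) determines Z at k = m+1 and k = -(m+1). *)
Lemma axis_solution a b m : exists Y : int -> rat,
  [/\ forall k, m%:Z < `|k| -> Y k = 0, forall k, Y (- k) = Y k,
      forall k, `|k| <= m%:Z -> iter (a + b).+1 cdiff Y k = iter a cdiff (kdelta 0) k
    & iter b cdiff Y 0 = - ((2 * m + 1)%:R * 'C(2 * m, m)%:R * 'C(2 * a, a)%:R * 'C(2 * b, b)%:R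
          / 'C(2 * (m + (a + b).+1), m + (a + b).+1)%:R)].
Proof.
have kd0N k : kdelta 0 (- k) = kdelta 0 k by rewrite /kdelta oppr_eq0.
set n := (a + b).+1.
have evE F c : (forall k, F (- k) = F k) -> forall k : int, iter c cdiff F (`|k|) = iter c cdiff F k.
  move=> hF k; have [->|->] : `|k| = k \/ `|k| = - k by lia.
    by [].
  by rewrite iter_cdiff_even.
elim: m => [|m [Y [suppY evY eqY valY]]].
  pose y : rat := (-1) ^+ a * 'C(2 * a, a)%:R / ((-1) ^+ n * 'C(2 * n, n)%:R).
  have nz : 'C(2 * n, n)%:R != 0 :> rat by rewrite pnatr_eq0 -lt0n bin_gt0; lia.
  exists (fun k => y * kdelta 0 k); split.
  - by move=> k hk; rewrite /kdelta; case: eqP => [|_]; [lia | rewrite mulr0].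
  - by move=> k; rewrite kd0N.
  - move=> k hk; have -> : k = 0 by lia.
    by rewrite iter_cdiffZ !iter_cdiff_kdelta_center /y; field; rewrite nz signr_eq0.
  - rewrite iter_cdiffZ iter_cdiff_kdelta_center /y !muln0 !add0n bin0.
    have -> : (-1) ^+ n = - ((-1) ^+ a * (-1) ^+ b) :> rat by rewrite /n exprS exprD mulN1r.
    by field; rewrite nz !signr_eq0.
pose p := (a + b)%N; pose X := sqprod m.+1 p.
pose mu c := iter c cdiff X 0.
have X0 k : m.+1%:Z < `|k| -> `|k| <= (m + n)%N%:Z -> X k = 0.
  by move=> h1 h2; apply: sqprod_eq0 => //; lia.
have Xev k : X (- k) = X k by apply: sqprod_even.
have defXm : X m.+1%:Z = _ := sqprod_base m.+1 p.
have := sqprod_above m.+1 p 0; rewrite -/X.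
have -> : (m.+1 + p + 1 + 0 = m.+1 + n)%N by rewrite /n /p; lia.
move=> defXt.
have Xm0 : X m.+1%:Z != 0.
  by rewrite defXm !(mulf_eq0, invr_eq0) !pnatr_eq0 !eqn0Ngt !fact_gt0.
have Xt0 : X (m.+1 + n)%N%:Z != 0.
  by rewrite defXt !(mulf_eq0, invr_eq0) signr_eq0 !pnatr_eq0 !eqn0Ngt !fact_gt0.
set Xm := X m.+1%:Z in defXm Xm0 *; set Xt := X (m.+1 + n)%N%:Z in defXt Xt0 *.
have EX k : iter n cdiff X k = 0 by apply: iter_cdiff_sqprod_gt.
pose Z k := iter n cdiff Y k - iter a cdiff (kdelta 0) k.
have ZX : X m.+1%:Z * Z m.+1%:Z + X (- m.+1%:Z) * Z (- m.+1%:Z) = - mu a.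
  rewrite -(@symsum_pair (m + n) (fun k => X k * Z k)); first last.
  - move=> k h1 h2; have [h3|h3] := leP `|k| m%:Z.
      by rewrite /Z eqY // subrr mulr0.
    by rewrite X0 ?mul0r //; lia.
  - by rewrite /n; lia.
  have -> : symsum (m + n) (fun k => X k * Z k) =
      symsum (m + n) (fun k => X k * iter n cdiff Y k) -
      symsum (m + n) (fun k => X k * iter a cdiff (kdelta 0) k).
    by rewrite /symsum -sumrB; apply: eq_bigr => i _; rewrite mulrBr.
  rewrite (@symsum_iter_cdiff _ _ _ _ m) //.
  rewrite (@symsum_iter_cdiff _ _ _ _ 0); last 2 first.
  - by move=> k hk; rewrite /kdelta; case: eqP => // e; lia.
  - by rewrite /n; lia.
  rewrite symsum_kdelta /symsum big1 ?sub0r // => i _.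
  by rewrite EX mul0r.
have evZ : Z (- m.+1%:Z) = Z m.+1%:Z by rewrite /Z !iter_cdiff_even.
rewrite Xev evZ -/Xm in ZX.
have defZ : Z m.+1%:Z = - mu a / (2 * Xm) by rewrite -ZX; field; rewrite Xm0.
pose x k := if `|k| <= m.+1%:Z then X k else 0.
pose c := - mu a / (2 * Xm * Xt).
have Ex k : `|k| <= m.+1%:Z -> iter n cdiff x k = - Xt * (`|k| == m.+1%:Z)%:R.
  move=> hk; pose x' j := X j + - Xt * (kdelta (m.+1 + n)%N%:Z j + kdelta (- (m.+1 + n)%N%:Z) j).
  rewrite (@iter_cdiff_local _ _ x') => [|j hj]; last first.
    rewrite /x /x'; case: leP => hj1.
      rewrite /kdelta; case: eqP => [e|_]; first by lia.
      by case: eqP => [e|_]; first lia; rewrite addr0 mulr0 addr0.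
    rewrite /kdelta; case: eqP => [->|n1].
      by case: eqP => [e|_]; first lia; rewrite -/Xt /= ?mulr0n ?mulr1n; ring.
    case: eqP => [->|n2]; first by rewrite Xev -/Xt /= ?mulr0n ?mulr1n; ring.
    rewrite X0; [by rewrite !addr0 mulr0|lia|lia].
  rewrite iter_cdiffD EX iter_cdiffZ iter_cdiffD add0r; congr (_ * _).
  have [e|ne] := eqVneq `|k| m.+1%:Z.
    have [->|->] : k = m.+1%:Z \/ k = - m.+1%:Z by lia.
      by rewrite iter_cdiff_kdelta1 ?iter_cdiff_kdelta0 ?addr0 //; lia.
    by rewrite addrC iter_cdiff_kdelta1 ?iter_cdiff_kdelta0 ?addr0 //; lia.
  by rewrite !iter_cdiff_kdelta0 ?addr0 //; lia.
exists (fun k => Y k + c * x k); split.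
- by move=> k hk; rewrite /x leNgt hk mulr0 addr0 suppY //; lia.
- by move=> k; rewrite evY /x normrN Xev.
- move=> k hk; rewrite iter_cdiffD iter_cdiffZ Ex //.
  have [e|ne] := eqVneq `|k| m.+1%:Z; last first.
    by rewrite eqY ?mulr0 ?addr0 //; lia.
  rewrite -(evE _ n evY) -(evE _ a kd0N) e.
  apply/eqP; rewrite -subr_eq0 addrAC -/(Z m.+1%:Z) defZ /c; apply/eqP; rewrite /= mulr1; field.
  by rewrite Xm0 Xt0.
rewrite iter_cdiffD iter_cdiffZ valY (@iter_cdiff_local b x X); last first.
  by move=> j hj; rewrite /x; case: leP => // h; rewrite X0 //; rewrite /n; lia.
have := iter_cdiff_sqprod0 m.+1 b a; have := iter_cdiff_sqprod0 m.+1 a b.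
rewrite [(b + a)%N]addnC -/p -/X -/(mu a) -/(mu b) => muaE mubE.
rewrite -/(mu b) /c muaE mubE defXm defXt !central_binE.
pose M := (m + p).+1; pose Q := (2 * m.+1 + p)%N.
have sgp : (-1) ^+ p = (-1) ^+ a * (-1) ^+ b :> rat by rewrite exprD.
have -> : (m.+1 + n = M.+1)%N by rewrite /M /n /p; lia.
have -> : (m + n = M)%N by rewrite /M /n /p; lia.
have -> : (m.+1 + a + b = M)%N by rewrite /M /p; lia.
have -> : (m.+1 + b + a = M)%N by rewrite /M /p; lia.
have -> : (2 * m.+1 + 2 * p + 1 + 0 = (2 * M).+1)%N by rewrite /M /p; lia.
have -> : (2 * m.+1 + p + 1 + 0 = Q.+1)%N by rewrite /Q; lia.
rewrite -/Q sgp addn0 fact0.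
have -> : (2 * m.+1 = (2 * m).+2)%N by lia.
have -> : (2 * M.+1 = (2 * M).+2)%N by lia.
have eQ : Q%:R = 2 * m%:R + 2 + p%:R :> rat by rewrite /Q natrD natrM -natr1; ring.
have eM : M%:R = m%:R + p%:R + 1 :> rat by rewrite /M -natr1 natrD.
have := fact_gt0 (m.+1 + a); have := fact_gt0 (m.+1 + b).
move: (m.+1 + a)`! (m.+1 + b)`! => U V hV hU.
have hU' : U%:R != 0 :> rat by rewrite pnatr_eq0 -lt0n.
have hV' : V%:R != 0 :> rat by rewrite pnatr_eq0 -lt0n.
have sg d : (-1) ^+ d != 0 :> rat by rewrite signr_eq0.
clearbody M Q p; rewrite !factS !natrM -!natr1 !natrD ?natrM -?natr1 eQ ?eM.
field; rewrite ?hU' ?hV' ?sg; nonzero.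
Qed.

(** * Determinants of adjacency matrices *)

Definition nbrs (r : int * int) : seq (int * int) :=
  [:: (r.1, r.2); (r.1, r.2 - 1); (r.1 - 1, r.2)].

Definition adjmx k (rs ls : seq (int * int)) : 'M[rat]_k :=
  \matrix_(i < k, j < k) (nth 0 ls j \in nbrs (nth 0 rs i))%:R.

Lemma perm_nth_perm (T : eqType) (x0 : T) k (s t : seq T) : size t = k -> perm_eq s t ->
  exists p : 'S_k, forall i : 'I_k, nth x0 s i = nth x0 t (p i).
Proof.
move=> /eqP st; have -> : t = tval (Tuple st) by [].
case/tuple_permP => p ->; exists p => i.
by rewrite -tnth_nth tnth_mktuple (tnth_nth x0).
Qed.

Lemma norm_det_adjmx_perm k (rs rs' ls ls' : seq (int * int)) :
  size rs' = k -> size ls' = k -> perm_eq rs rs' -> perm_eq ls ls' ->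
  `|\det (adjmx k rs ls)| = `|\det (adjmx k rs' ls')|.
Proof.
move=> sr sl /(perm_nth_perm 0 sr)[p hp] /(perm_nth_perm 0 sl)[q hq].
have -> : adjmx k rs ls = row_perm p (col_perm q (adjmx k rs' ls')).
  by apply/matrixP => i j; rewrite !mxE hp hq.
rewrite row_permE col_permE !det_mulmx !det_perm !normrM !normrX normrN1 !expr1n.
by rewrite mul1r mulr1.
Qed.

(* Independent of the enumerations of R and L; meaningful when #|R| = #|L|. *)
Definition ndet (R L : {fset int * int}) : rat := `|\det (adjmx #|` R| R L)|.

Lemma ndetE (R L : {fset int * int}) (rs ls : seq (int * int)) k : #|` R| = k -> #|` L| = k ->
  perm_eq rs R -> perm_eq ls L -> ndet R L = `|\det (adjmx k rs ls)|.
Proof.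
move=> hR hL pr pl; rewrite /ndet hR; apply: norm_det_adjmx_perm.
- by rewrite (perm_size pr) -hR.
- by rewrite (perm_size pl) -hL.
- by rewrite perm_sym.
- by rewrite perm_sym.
Qed.

Lemma perm_fset1 (A : {fset int * int}) x : x \in A -> perm_eq (x :: (A `\ x)%fset) A.
Proof.
move=> xA; apply: uniq_perm; rewrite /= ?fset_uniq ?andbT //.
  by rewrite !inE eqxx.
by move=> y; rewrite !inE; case: eqP => [->|//]; rewrite xA.
Qed.

Lemma adjmx_cons k r rs l ls :
  row' 0 (col' 0 (adjmx k.+1 (r :: rs) (l :: ls))) = adjmx k rs ls.
Proof. by apply/matrixP => i j; rewrite !mxE. Qed.

Lemma ndet_cons (R L : {fset int * int}) r l k : #|` R| = k.+1 -> #|` L| = k.+1 -> r \in R -> l \in L ->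
  let A := adjmx k.+1 (r :: (R `\ r)%fset) (l :: (L `\ l)%fset) in
  ndet R L = `|\det A| /\ ndet (R `\ r)%fset (L `\ l)%fset = `|cofactor A 0 0|.
Proof.
move=> hR hL hr hl A; split; first by apply: ndetE => //; apply: perm_fset1.
rewrite /A /cofactor adjmx_cons expr0 mul1r; apply: ndetE => //.
- by have := cardfsD1 r R; rewrite hr hR; lia.
- by have := cardfsD1 l L; rewrite hl hL; lia.
Qed.

Lemma sum_nbrs (L : {fset int * int}) (f : int * int -> rat) r :
  \sum_(l <- L) (l \in nbrs r)%:R * f l =
  \sum_(l <- nbrs r) (l \in L)%:R * f l.
Proof.
have key (s t : seq (int * int)) :
    \sum_(l <- s) (l \in t)%:R * f l = \sum_(l <- [seq l <- s | l \in t]) f l.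
  rewrite big_filter [RHS]big_mkcond; apply: eq_bigr => l _.
  by case: ifP => _; rewrite ?mul1r ?mul0r.
have un : uniq (nbrs r) by rewrite /= !inE !xpair_eqE; lia.
rewrite (key L) (key (nbrs r) L); apply: perm_big.
apply: uniq_perm; rewrite ?filter_uniq ?fset_uniq // => l.
by rewrite !mem_filter andbC.
Qed.

Lemma ndet_cramer (R L : {fset int * int}) (f : int * int -> rat) r0 l0 :
  #|` R| = #|` L| -> r0 \in R -> l0 \in L ->
  (forall r, r \in R -> \sum_(l <- nbrs r) (l \in L)%:R * f l = (r == r0)%:R) ->
  ndet (R `\ r0)%fset (L `\ l0)%fset = ndet R L * `|f l0|.
Proof.
move=> eRL hr hl hf; have [k hR] : exists k, #|` R| = k.+1.
  by exists #|` (R `\ r0)%fset|; have := cardfsD1 r0 R; rewrite hr.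
have hL : #|` L| = k.+1 by rewrite -eRL.
have [-> ->] := ndet_cons hR hL hr hl; set A := adjmx _ _ _.
pose v : 'cV[rat]_k.+1 := \col_j f (nth 0 (l0 :: (L `\ l0)%fset) j).
have pR := perm_fset1 hr; have pL := perm_fset1 hl.
have sR : size (r0 :: (R `\ r0)%fset) = k.+1 by rewrite (perm_size pR) -hR.
have sL : size (l0 :: (L `\ l0)%fset) = k.+1 by rewrite (perm_size pL) -hL.
have Av : A *m v = delta_mx 0 0.
  apply/colP => i; rewrite !mxE eqxx andbT.
  set r := nth 0 (r0 :: (R `\ r0)%fset) i.
  have rR : r \in R by rewrite -(perm_mem pR) mem_nth // sR.
  have -> : (i == 0) = (r == r0).
    rewrite -[r0 in RHS]/(nth 0 (r0 :: (R `\ r0)%fset) 0) nth_uniq ?sR //.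
    by rewrite (perm_uniq pR) fset_uniq.
  rewrite -hf // -sum_nbrs -(perm_big _ pL) [RHS](big_nth 0) sL big_mkord.
  by apply: eq_bigr => j _; rewrite !mxE.
have := congr1 (mulmx (\adj A)) Av; rewrite mulmxA mul_adj_mx mul_scalar_mx.
move/colP => /(_ 0); rewrite !mxE /= (bigD1 0) //= !mxE eqxx mulr1.
rewrite big1 => [|i /negPf ne]; last by rewrite !mxE ne mulr0.
by rewrite addr0 => <-; rewrite normrM.
Qed.

Lemma ndet_forced (R L : {fset int * int}) r l :
  #|` R| = #|` L| -> r \in R -> l \in L -> l \in nbrs r ->
  (forall l', l' \in L -> l' \in nbrs r -> l' = l) \/
  (forall r', r' \in R -> l \in nbrs r' -> r' = r) ->
  ndet (R `\ r)%fset (L `\ l)%fset = ndet R L.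
Proof.
move=> eRL hr hl rl H; have [k hR] : exists k, #|` R| = k.+1.
  by exists #|` (R `\ r)%fset|; have := cardfsD1 r R; rewrite hr.
have hL : #|` L| = k.+1 by rewrite -eRL.
have [-> ->] := ndet_cons hR hL hr hl; set A := adjmx _ _ _.
have pR := perm_fset1 hr; have pL := perm_fset1 hl.
have sR : size (r :: (R `\ r)%fset) = k.+1 by rewrite (perm_size pR) -hR.
have sL : size (l :: (L `\ l)%fset) = k.+1 by rewrite (perm_size pL) -hL.
have A00 : A 0 0 = 1 by rewrite mxE rl.
have uL : uniq (l :: (L `\ l)%fset) by rewrite (perm_uniq pL) fset_uniq.
have uR : uniq (r :: (R `\ r)%fset) by rewrite (perm_uniq pR) fset_uniq.
case: H => H.
  rewrite (expand_det_row A 0) (bigD1 0) //= A00 mul1r big1 ?addr0 // => j ne.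
  suff -> : A 0 j = 0 by rewrite mul0r.
  rewrite mxE /=; case: (boolP (_ \in nbrs _)) => // h; case/eqP: ne.
  apply/val_inj/eqP; rewrite -(nth_uniq 0 _ _ uL) ?sL ?ltn_ord //=.
  by apply/eqP/H => //; rewrite -(perm_mem pL) mem_nth ?sL.
rewrite (expand_det_col A 0) (bigD1 0) //= A00 mul1r big1 ?addr0 // => i ne.
suff -> : A i 0 = 0 by rewrite mul0r.
rewrite mxE /=; case: (boolP (_ \in nbrs _)) => // h; case/eqP: ne.
apply/val_inj/eqP; rewrite -(nth_uniq 0 _ _ uR) ?sR ?ltn_ord //=.
by apply/eqP/H => //; rewrite -(perm_mem pR) mem_nth ?sR.
Qed.

(** * The hexagon without hole *)

Definition hexbox (n N : nat) : seq (int * int) :=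
  [seq (i%:Z, j%:Z - n%:Z) | i <- iota 0 (2 * n), j <- iota 0 (n + N)].

Definition hexR (n N : nat) : {fset int * int} :=
  [fset p in hexbox n N | (0 <= p.1 + p.2 < (n + N)%:Z)%R]%fset.

Definition hexL (n N : nat) : {fset int * int} :=
  [fset p in hexbox n N | (0 <= p.1 + p.2 + 1 < (n + N)%:Z)%R]%fset.

Lemma mem_hexbox n N p :
  (p \in hexbox n N) = (0 <= p.1 < (2 * n)%:Z) && (- n%:Z <= p.2 < N%:Z).
Proof.
apply/allpairsP/idP => [[[i j] /= []]|].
  by rewrite !mem_iota => hi hj -> /=; lia.
case: p => a b /= h; exists (absz a, absz (b + n%:Z)); rewrite !mem_iota /=.
by split; [lia | lia | congr pair; lia].
Qed.

Lemma mem_hexR n N p : (p \in hexR n N) =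
  [&& 0 <= p.1 < (2 * n)%:Z, - n%:Z <= p.2 < N%:Z & 0 <= p.1 + p.2 < (n + N)%:Z].
Proof. by rewrite !inE mem_hexbox -!andbA. Qed.

Lemma mem_hexL n N p : (p \in hexL n N) =
  [&& 0 <= p.1 < (2 * n)%:Z, - n%:Z <= p.2 < N%:Z & 0 <= p.1 + p.2 + 1 < (n + N)%:Z].
Proof. by rewrite !inE mem_hexbox -!andbA. Qed.

Lemma card_hexLR n N : #|` hexR n N| = #|` hexL n N|.
Proof.
pose rho (p : int * int) : int * int := ((2 * n)%:Z - 1 - p.1, N%:Z - 1 - n%:Z - p.2).
have rhoK : involutive rho by case=> a b; rewrite /rho /=; congr pair; lia.
have -> : hexL n N = [fset rho p | p in hexR n N]%fset.
  apply/fsetP => p; apply/idP/imfsetP => [h|[q /= h ->]].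
    exists (rho p); last by rewrite rhoK.
    by move: h; rewrite /= mem_hexR mem_hexL /rho /=; lia.
  by move: h; rewrite /= mem_hexR mem_hexL /rho /=; lia.
rewrite [RHS]card_imfset; last exact: inv_inj.
by [].
Qed.

Lemma iter_bdiff_supp a F (lo hi : int) : (forall k, (k < lo) || (hi < k) -> F k = 0) ->
  forall k, (k < lo) || (hi + a%:Z < k) -> iter a bdiff F k = 0.
Proof.
move=> h; elim: a => [|a IH] k hk; first by apply: h; lia.
by rewrite iterS /bdiff !IH ?subrr //; lia.
Qed.

Lemma iter_bdiff_local a F G (k : int) :
  (forall j, k - a%:Z <= j <= k -> F j = G j) -> iter a bdiff F k = iter a bdiff G k.
Proof.
elim: a k => [|a IH] k e; first by apply: e; lia.
by rewrite !iterS /bdiff !IH // => j hj; apply: e; lia.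
Qed.

Lemma iter_bdiff_kdelta0 a p (k : int) : (k < p) || (p + a%:Z < k) -> iter a bdiff (kdelta p) k = 0.
Proof.
by apply: iter_bdiff_supp => j hj; rewrite /kdelta; case: eqP => // e; lia.
Qed.

Lemma iter_bdiff_kdelta1 a p : iter a bdiff (kdelta p) p = 1.
Proof.
elim: a => [|a IH]; first by rewrite /= /kdelta eqxx.
by rewrite iterS /bdiff IH iter_bdiff_kdelta0 ?subr0 //; lia.
Qed.

Section Solution.
Variables (n N a0 : nat) (b0 : int) (y : int -> rat).
Hypothesis r0H : (a0%:Z, b0) \in hexR n N.
Hypothesis suppy : forall b, (b < - n%:Z) || (N%:Z - 1 - n%:Z < b) -> y b = 0.
Hypothesis eqy : forall b, 0 <= b < N%:Z ->
  iter (2 * n) bdiff y b = iter a0 bdiff (kdelta b0) b.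

(* Column a = j - 1 of the solution up to signs.  The column j = 0 lies outside
   the hexagon, and [eqy] says that it vanishes where it touches it. *)
Definition column (j : nat) (b : int) : rat :=
  iter (2 * n - j) bdiff y b - (j <= a0)%:R * iter (a0 - j) bdiff (kdelta b0) b.

Lemma columnS j b : (j < 2 * n)%N ->
  column j.+1 b - column j.+1 (b - 1) = column j b + (j == a0)%:R * kdelta b0 b.
Proof.
move=> hj; rewrite /column.
have -> : (2 * n - j = (2 * n - j.+1).+1)%N by lia.
rewrite iterS /bdiff; have [lt|gt|->] := ltngtP j a0.
- have -> : (a0 - j = (a0 - j.+1).+1)%N by lia.
  by rewrite iterS /bdiff /=; ring.
- by rewrite !mul0r; ring.
- by rewrite subnn /= !mul0r; ring.
Qed.

Definition tri_sol (l : int * int) : rat :=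
  (-1) ^ (l.1 + l.2 + a0%:Z + b0) * column (absz (l.1 + 1)) l.2.

Lemma tri_solP r : r \in hexR n N ->
  \sum_(l <- nbrs r) (l \in hexL n N)%:R * tri_sol l = (r == (a0%:Z, b0))%:R.
Proof.
case: r => a b hr; have := hr; rewrite mem_hexR /= => ha.
have a0H : (a0 < 2 * n)%N by move: r0H; rewrite mem_hexR /=; lia.
have hb0 : [&& - n%:Z <= b0 < N%:Z & 0 <= a0%:Z + b0 < (n + N)%:Z].
  by move: r0H; rewrite mem_hexR /=; lia.
have [j ej] : exists j : nat, a = j%:Z by exists (absz a); lia.
subst a; rewrite /nbrs !big_cons big_nil addr0 /=.
have drop l : (l \notin hexL n N -> tri_sol l = 0) ->
    (l \in hexL n N)%:R * tri_sol l = tri_sol l.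
  by case: (boolP (l \in _)) => [_ _|_ ->]; rewrite ?mul1r // mul0r.
have out c i : (c < - n%:Z) || (N%:Z - n%:Z + (2 * n)%:Z - i%:Z - 1 < c) -> (i <= 2 * n)%N ->
    ((i <= a0)%N -> (a0%:Z - i%:Z + b0 < c) || (c < - n%:Z)) -> column i c = 0.
  move=> h hi h'; rewrite /column (iter_bdiff_supp suppy) ?sub0r; last by lia.
  case: leqP => hi'; last by rewrite mul0r oppr0.
  by rewrite iter_bdiff_kdelta0 ?mulr0 ?oppr0 //; lia.
rewrite (drop (j%:Z, b)); last first.
  by rewrite mem_hexL /= /tri_sol /= => h; rewrite out ?mulr0 //; lia.
rewrite (drop (j%:Z, b - 1)); last first.
  by rewrite mem_hexL /= /tri_sol /= => h; rewrite out ?mulr0 //; lia.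
rewrite (drop (j%:Z - 1, b)); last first.
  rewrite mem_hexL /= /tri_sol /= => h; have -> : j = 0%N by lia.
  by rewrite /= /column !subn0 mul1r eqy ?subrr ?mulr0 //; lia.
have tE (a c : int) : tri_sol (a, c) = (-1) ^ (a + c + a0%:Z + b0) * column (absz (a + 1)) c by [].
rewrite !tE.
have -> : absz (j%:Z + 1) = j.+1 by lia.
have -> : absz (j%:Z - 1 + 1) = j by lia.
have sg1 (x : int) : (-1) ^ (x - 1) = - (-1) ^ x :> rat.
  by rewrite expfzDr // mulrN1.
have -> : j%:Z + (b - 1) + a0%:Z + b0 = j%:Z + b + a0%:Z + b0 - 1 by lia.
have -> : j%:Z - 1 + b + a0%:Z + b0 = j%:Z + b + a0%:Z + b0 - 1 by lia.
have comb (s X Y Z : rat) : s * X + (- s * Y + - s * Z) = s * (X - Y - Z) by ring.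
rewrite sg1 comb columnS; last by lia.
rewrite [column j b + _]addrC addrK /kdelta xpair_eqE.
have -> : (j%:Z == a0%:Z) = (j == a0) by [].
case: eqP => [->|_]; last by rewrite mul0r mulr0.
case: eqP => [->|_]; last by rewrite !mulr0.
have -> : a0%:Z + b0 + a0%:Z + b0 = (a0%:Z + b0) + (a0%:Z + b0) by lia.
by rewrite expfzDr // -expfzMl mulrNN !mulr1 exp1rz.
Qed.
End Solution.

Lemma normrN1z (z : int) : `|(-1) ^ z| = 1 :> rat.
Proof. by case: z => c; rewrite /= ?normfV normrX normrN1 expr1n ?invr1. Qed.

Lemma ndet_remove n N a0 a1 (b0 b1 : int) (y : int -> rat) :
  (a0%:Z, b0) \in hexR n N -> (a1%:Z, b1) \in hexL n N -> (a0 <= a1)%N ->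
  (forall b, (b < - n%:Z) || (N%:Z - 1 - n%:Z < b) -> y b = 0) ->
  (forall b, 0 <= b < N%:Z -> iter (2 * n) bdiff y b = iter a0 bdiff (kdelta b0) b) ->
  ndet (hexR n N `\ (a0%:Z, b0))%fset (hexL n N `\ (a1%:Z, b1))%fset =
  ndet (hexR n N) (hexL n N) * `|iter (2 * n - a1.+1) bdiff y b1|.
Proof.
move=> h0 h1 le01 sy ey.
rewrite (ndet_cramer (card_hexLR n N) h0 h1 (tri_solP h0 sy ey)).
rewrite /tri_sol normrM normrN1z mul1r; congr (_ * `|_|).
rewrite (_ : absz ((a1%:Z, b1).1 + 1) = a1.+1); last by rewrite /=; lia.
by rewrite /column ltnNge le01 mul0r subr0.
Qed.

(* The rhombi (r, phi r) with r in Q are forced in the order of rk. *)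
Lemma ndet_forced_chain (rk : int * int -> nat) (R L Q : {fset int * int}) :
  let phi r : int * int := (r.1 - 1, r.2) in
  #|` R| = #|` L| -> (Q `<=` R)%fset -> (forall r, r \in Q -> phi r \in L) ->
  (forall r, r \in Q ->
     (forall l, l \in L -> l \in nbrs r ->
        l = phi r \/ exists2 r', (r' \in Q) && (rk r' < rk r)%N & l = phi r') \/
     (forall r', r' \in R -> phi r \in nbrs r' ->
        r' = r \/ (r' \in Q) && (rk r' < rk r)%N)) ->
  ndet (R `\` Q)%fset (L `\` [fset phi r | r in Q])%fset = ndet R L.
Proof.
move=> phi; have phiI : injective phi.
  by case=> [a b] [c d] [] e1 e2; congr pair; rewrite /= in e1 e2; lia.
move: {2}(#|` Q|) (erefl #|` Q|) => k; elim: k R L Q => [|k IH] R L Q hk eRL sQR hL hc.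
  have -> : Q = fset0 by apply/cardfs0_eq.
  rewrite fsetD0; congr ndet; apply/fsetP => l; rewrite !inE; apply: andb_idl => _.
  by apply/imfsetP => -[].
have [r rQ rmin] : exists2 r, r \in Q & forall r', r' \in Q -> (rk r <= rk r')%N.
  have [r0 r0Q] : exists r, r \in Q by apply/fset0Pn; rewrite -cardfs_gt0 hk.
  have ex : exists d, [exists r : Q, rk (val r) == d].
    by exists (rk r0); apply/existsP; exists [` r0Q]%fset.
  case: (ex_minnP ex) => d /existsP[r /eqP er] hd; exists (val r); first exact: valP.
  by move=> r' r'Q; rewrite er; apply: hd; apply/existsP; exists [` r'Q]%fset.
have rR : r \in R by apply: (fsubsetP sQR).
have lL := hL r rQ.
rewrite -(ndet_forced eRL rR lL); first last.
- case: (hc r rQ) => h; [left|right] => z hz1 hz2.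
    case: (h z hz1 hz2) => // -[r' /andP[r'Q lt]]; have := rmin _ r'Q; lia.
  case: (h z hz1 hz2) => // /andP[r'Q lt]; have := rmin _ r'Q; lia.
- by rewrite /nbrs !inE eqxx !orbT.
have Qr x : (x \in Q `\ r)%fset = (x != r) && (x \in Q) by rewrite !inE.
rewrite -(IH (R `\ r)%fset (L `\ phi r)%fset (Q `\ r)%fset).
- congr ndet; apply/fsetP => z; rewrite !inE.
    by case: eqP => [->|//]; rewrite rQ.
  apply/idP/idP => [/andP[h1 ->]|/andP[h1 /andP[h2 ->]]]; rewrite ?andbT.
    apply/andP; split.
      apply/imfsetP => -[x /=]; rewrite Qr => /andP[_ xQ] ex.
      by case/imfsetP: h1; exists x.
    by apply: contraNneq h1 => ->; apply/imfsetP; exists r.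
  apply/imfsetP => -[x /= xQ ex]; case/imfsetP: h1; exists x => //=; rewrite Qr xQ andbT.
  by apply: contraNneq h2 => <-; rewrite ex.
- by have := cardfsD1 r Q; rewrite rQ hk; lia.
- by have := cardfsD1 r R; have := cardfsD1 (phi r) L; rewrite rR lL eRL; lia.
- by apply/fsubsetP => x; rewrite !inE => /andP[-> /(fsubsetP sQR)].
- by move=> x; rewrite Qr !inE => /andP[ne xQ]; rewrite (inj_eq phiI) ne hL.
move=> x; rewrite Qr => /andP[ne xQ]; case: (hc x xQ) => h; [left|right] => z.
  rewrite in_fsetD1 => /andP[nz zL] zx; case: (h z zL zx) => [|[r' /andP[r'Q lt] e]]; first by left.
  right; exists r' => //; rewrite Qr r'Q lt !andbT.
  by apply: contraNneq nz => <-; rewrite e.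
rewrite in_fsetD1 => /andP[nz zR] zx; case: (h z zR zx) => [|/andP[zQ lt]]; first by left.
by right; rewrite Qr nz zQ lt.
Qed.

Lemma iter_bdiff_linear a (c : rat) F : (forall k, iter a bdiff F k = 0) ->
  forall k, iter a.+1 bdiff (fun j => (j%:~R + c) * F j) k = 0.
Proof.
move=> h k.
rewrite (eq_iter_bdiff _ (G := fun j => j%:~R * F j - (- c) * F j)); last by move=> j; ring.
have e j : iter a.+1 bdiff F j = 0 by rewrite iterS /bdiff !h subrr.
by rewrite iter_bdiffB iter_bdiffZ iter_bdiff_mul !e h !mulr0 addr0 subr0.
Qed.

Definition linprod (p : nat) (d : int) (b : int) : rat :=
  \prod_(t < p) (b%:~R + (t%:Z + d)%:~R).

Lemma linprodS p d b : linprod p.+1 d b = (b%:~R + (p%:Z + d)%:~R) * linprod p d b.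
Proof. by rewrite /linprod big_ord_recr mulrC. Qed.

Lemma ndet0 : ndet fset0 fset0 = 1.
Proof. by rewrite /ndet cardfs0 det_mx00 normr1. Qed.

Lemma ndet_hex0 n : ndet (hexR n 0) (hexL n 0) = 1.
Proof.
rewrite -(@ndet_forced_chain (fun r => absz r.1) _ _ (hexR n 0)) ?card_hexLR ?fsubset_refl //.
- rewrite fsetDv [X in ndet _ X](_ : _ = fset0) ?ndet0 //.
  apply/fsetP => -[a b]; rewrite in_fsetD [RHS]inE mem_hexL; apply/negP => /andP[h1 h2].
  case/imfsetP: h1; exists (a + 1, b) => /=; last by rewrite addrK.
  by rewrite mem_hexR /=; move: h2 => /=; lia.
- by move=> [a b]; rewrite mem_hexR mem_hexL /=; lia.
move=> [a b]; rewrite mem_hexR => h /=; right=> -[c d].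
rewrite mem_hexR /nbrs !inE !xpair_eqE /= => h1 h2.
have [e|e] : (c = a /\ d = b) \/ c = a - 1 by move: h h1 h2 => /=; lia.
  by left; case: e => -> ->.
by right; move: h h1 h2 => /=; lia.
Qed.

(* Without the two ends of its top strip, the hexagon has forced rhombi in the
   whole strip. *)
Lemma ndet_hex_strip n N : (0 < n)%N ->
  ndet (hexR n N.+1 `\ (0, N%:Z))%fset (hexL n N.+1 `\ ((2 * n).-1%:Z, N%:Z - n%:Z))%fset =
  ndet (hexR n N) (hexL n N).
Proof.
move=> n0; set R := (hexR n N.+1 `\ _)%fset; set L := (hexL n N.+1 `\ _)%fset.
have mR r : (r \in R) = (r != (0, N%:Z)) && (r \in hexR n N.+1) by rewrite in_fsetD1.
have mL l : (l \in L) = (l != ((2 * n).-1%:Z, N%:Z - n%:Z)) && (l \in hexL n N.+1).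
  by rewrite in_fsetD1.
pose Q : {fset int * int} := [fset r in R | ((r.2 == N%:Z) || (r.1 + r.2 == (n + N)%:Z))%R]%fset.
have mQ r : (r \in Q) = (r \in R) && ((r.2 == N%:Z) || (r.1 + r.2 == (n + N)%:Z)).
  by rewrite !inE.
rewrite -(@ndet_forced_chain (fun r => if r.2 == N%:Z then absz r.1 else absz ((2 * n)%:Z - r.1)%R) R L Q).
- congr ndet; apply/fsetP => -[a b].
    rewrite in_fsetD mQ mR !mem_hexR !xpair_eqE /=; lia.
  rewrite in_fsetD mem_hexL mL mem_hexL xpair_eqE /=.
  have -> : ((a, b) \in [fset ((r.1 - 1)%R, r.2) | r in Q]%fset) = ((a + 1, b) \in Q).
    apply/imfsetP/idP => [[[c d] /= h [-> ->]]|h]; first by rewrite subrK.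
    by exists (a + 1, b) => //=; rewrite addrK.
  rewrite mQ mR mem_hexR xpair_eqE /=; lia.
- have h0 : (0, N%:Z) \in hexR n N.+1 by rewrite mem_hexR /=; lia.
  have h1 : ((2 * n).-1%:Z, N%:Z - n%:Z) \in hexL n N.+1 by rewrite mem_hexL /=; lia.
  have := card_hexLR n N.+1; rewrite (cardfsD1 (0, N%:Z) (hexR n N.+1)) h0.
  by rewrite (cardfsD1 ((2 * n).-1%:Z, N%:Z - n%:Z) (hexL n N.+1)) h1 => /addnI.
- by apply/fsubsetP => r; rewrite mQ => /andP[].
- by move=> [a b]; rewrite mQ mR mL mem_hexL mem_hexR !xpair_eqE /=; lia.
move=> [a b]; rewrite mQ mR mem_hexR xpair_eqE /= => h.
have [eb|nb] := eqVneq b N%:Z.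
  right=> -[c d]; rewrite mQ mR mem_hexR /nbrs !inE !xpair_eqE /= => h1 h2.
  have [e|[e1 e2]] : (c = a /\ d = b) \/ (c = a - 1 /\ d = b) by lia.
    by left; case: e => -> ->.
  by right; subst c d; rewrite eb eqxx /=; lia.
left=> -[c d]; rewrite mL mem_hexL /nbrs !inE !xpair_eqE /= => h1 h2.
have [e|[e1 e2]] : (c = a - 1 /\ d = b) \/ (c = a /\ d = b - 1) by lia.
  by left; case: e => -> ->.
right; exists (a + 1, b - 1); last by rewrite e1 e2 /= addrK.
have -> : (b - 1 == N%:Z) = false by lia.
rewrite mQ mR mem_hexR xpair_eqE /=; subst c d; clear -h h1 nb; lia.
Qed.

Lemma linprod_eq0 p (d b : int) (t : nat) : (t < p)%N -> b = - (t%:Z + d) -> linprod p d b = 0.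
Proof.
move=> lt e; rewrite /linprod (bigD1 (Ordinal lt)) //= -rmorphD e addNr mul0r //.
Qed.

Lemma iter_bdiff_linprod p d F a : (forall k, iter a bdiff F k = 0) ->
  forall k, iter (a + p) bdiff (fun j => linprod p d j * F j) k = 0.
Proof.
move=> h; elim: p => [|p IH] k.
  rewrite addn0 (eq_iter_bdiff _ (G := F)) // => j.
  by rewrite /linprod big_ord0 mul1r.
rewrite addnS (eq_iter_bdiff _ (G := fun j => (j%:~R + (p%:Z + d)%:~R) * (linprod p d j * F j))).
  exact: iter_bdiff_linear.
by move=> j; rewrite linprodS mulrA.
Qed.

Lemma prod_succ p : \prod_(t < p) (t.+1)%:R = p`!%:R :> rat.
Proof.
elim: p => [|p IH]; first by rewrite big_ord0.
by rewrite big_ord_recr /= IH factS natrM mulrC.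
Qed.

Lemma ndet_hexS n N : (0 < n)%N ->
  ndet (hexR n N) (hexL n N) =
  ndet (hexR n N.+1) (hexL n N.+1) *
    \prod_(t < n) ((N + t.+1)%:R / (N + n + t.+1)%:R).
Proof.
move=> n0; rewrite -(ndet_hex_strip N n0).
pose W b := linprod n (n%:Z + 1) b * (linprod n.-1 (1 - N%:Z) b * 1).
have W0 k : iter (2 * n) bdiff W k = 0.
  have -> : (2 * n = 1 + n.-1 + n)%N by lia.
  apply: iter_bdiff_linprod; apply: iter_bdiff_linprod => j.
  by rewrite /= /bdiff subrr.
have WN : W N%:Z = (\prod_(t < n) (N + n + t.+1)%:R) * (n.-1)`!%:R.
  rewrite /W mulr1 /linprod -prod_succ; congr (_ * _);
    by apply: eq_bigr => t _; rewrite -rmorphD pmulrn; congr (_%:~R); lia.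
have WNn : `|W (N%:Z - n%:Z)| = (\prod_(t < n) (N + t.+1)%:R) * (n.-1)`!%:R.
  rewrite /W mulr1 /linprod normrM -prod_succ !normr_prod; congr (_ * _).
    apply: eq_bigr => t _; rewrite -rmorphD.
    have -> : N%:Z - n%:Z + (t%:Z + (n%:Z + 1)) = (N + t.+1)%N%:Z by lia.
    by rewrite ger0_norm ?ler0n.
  rewrite (reindex_inj rev_ord_inj) /=; apply: eq_bigr => t _; rewrite -rmorphD.
  have -> : N%:Z - n%:Z + ((n.-1 - t.+1)%N%:Z + (1 - N%:Z)) = - t.+1%:Z.
    by have := ltn_ord t; lia.
  by rewrite rmorphN normrN /= ger0_norm ?ler0n.
have WN0 : W N%:Z != 0.
  rewrite WN mulf_neq0 ?pnatr_eq0 -?lt0n ?fact_gt0 //.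
  by apply/prodf_neq0 => t _; rewrite pnatr_eq0; lia.
pose y (b : int) := if (- n%:Z <= b <= N%:Z - n%:Z) then - W b / W N%:Z else 0.
rewrite (@ndet_remove n N.+1 0 (2 * n).-1 N%:Z (N%:Z - n%:Z) y) //; first last.
- move=> b hb; rewrite (@iter_bdiff_local _ _ (fun j => (- (W N%:Z)^-1) * W j - (-1) * kdelta N%:Z j)).
    rewrite iter_bdiffB !iter_bdiffZ W0 mulr0 sub0r mulN1r opprK /=.
    have [lt|ge] := ltP b N%:Z.
      by rewrite iter_bdiff_kdelta0 /kdelta ?lt //; case: eqP => // e; lia.
    have -> : b = N%:Z by lia.
    by rewrite iter_bdiff_kdelta1 /kdelta eqxx.
  move=> j hj; rewrite mulN1r opprK /y /kdelta; case: ifP => hj1.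
    by case: eqP => [e|_]; [lia | rewrite addr0; field].
  case: eqP => [->|ne]; first by rewrite mulNr mulVf // addNr.
  rewrite addr0; suff -> : W j = 0 by rewrite mulr0.
  have [lt|ge] := ltP j (- n%:Z).
    by rewrite /W (@linprod_eq0 _ _ _ (absz (- n%:Z - 1 - j)%R)) ?mul0r //; lia.
  by rewrite /W mulr1 mulrC (@linprod_eq0 _ _ _ (absz (N%:Z - 1 - j)%R)) ?mul0r //; lia.
- by move=> b hb; rewrite /y ifF //; lia.
- by rewrite mem_hexL /=; lia.
- by rewrite mem_hexR /=; lia.
congr (_ * _).
have -> : (2 * n - (2 * n).-1.+1 = 0)%N by lia.
rewrite /= /y ifT; last by lia.
rewrite normrM normrN normfV WNn WN normrM [Num.norm (factorial _)%:R]ger0_norm ?ler0n //.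
rewrite [Num.norm (\prod_(_ < _) _)]ger0_norm ?prodr_ge0 //.
rewrite prodf_div -mulf_div divff ?mulr1 // pnatr_eq0 -lt0n fact_gt0 //.
Qed.

Lemma telescope_prod (F : nat -> rat) n : (forall t, F t != 0) ->
  \prod_(t < n) (F t.+1 / F t) = F n / F 0%N.
Proof.
move=> nz; elim: n => [|n IH]; first by rewrite big_ord0 divff.
by rewrite big_ord_recr IH /= mulrC mulrA divfK.
Qed.

Lemma ndet_hex n N : (0 < n)%N ->
  ndet (hexR n N) (hexL n N) =
  \prod_(1 <= i < n.+1) \prod_(1 <= j < n.+1) \prod_(1 <= k < N.+1)
        (((i + j + k)%:R - 1) / ((i + j + k)%:R - 2)).
Proof.
move=> n0; elim: N => [|N IH].
  rewrite ndet_hex0 big1 // => i _; rewrite big1 // => j _; by rewrite big_geq.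
have nz : \prod_(t < n) ((N + t.+1)%:R / (N + n + t.+1)%:R) != 0 :> rat.
  by apply/prodf_neq0 => t _; rewrite mulf_neq0 ?invr_eq0 ?pnatr_eq0; lia.
apply: (mulIf nz); rewrite -ndet_hexS // IH.
rewrite [in RHS](eq_big_nat _ _ (F2 := fun i =>
  (\prod_(1 <= j < n.+1) \prod_(1 <= k < N.+1)
        (((i + j + k)%:R - 1) / ((i + j + k)%:R - 2))) * ((i + n + N)%:R / (i + N)%:R))).
  rewrite big_split /= -mulrA [X in _ = _ * X](_ : _ = 1) ?mulr1 //.
  rewrite big_add1 /= big_mkord -big_split big1 //= => t _.
  have -> : (t.+1 + n + N = N + n + t.+1)%N by lia.
  have -> : (t.+1 + N = N + t.+1)%N by lia.
  by rewrite mulf_div [X in X / _]mulrC divff // mulf_neq0 ?pnatr_eq0; lia.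
move=> i hi.
rewrite (eq_big_nat _ _ (F2 := fun j =>
  (\prod_(1 <= k < N.+1) (((i + j + k)%:R - 1) / ((i + j + k)%:R - 2))) *
     ((i + j + N)%:R / (i + j.-1 + N)%:R))).
  rewrite big_split; congr (_ * _) => /=.
  rewrite big_add1 /= big_mkord (telescope_prod (F := fun t => (i + t + N)%:R)) ?addn0 //.
  by move=> t; rewrite pnatr_eq0; lia.
move=> j hj; rewrite big_nat_recr //=; congr (_ * _).
rewrite addnS -natr1 addrK natr1; congr (_ / _).
have -> : ((i + j + N).+1 = i + j.-1 + N + 2)%N by lia.
by rewrite natrD addrK.
Qed.

(** * Signs of matchings *)

Lemma sum_pairs k (f : 'I_k -> 'I_k -> nat) : (forall i, f i i = 0%N) ->
  (\sum_(i < k) \sum_(j < k) f i j = \sum_(i < k) \sum_(j < k | (i < j)%N) (f i j + f j i))%N.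
Proof.
move=> fi; under [RHS]eq_bigr => i _ do rewrite big_split.
rewrite big_split [X in (_ = _ + X)%N](exchange_big_dep xpredT) //= -big_split.
apply: eq_bigr => i _ /=; rewrite (bigID (fun j : 'I_k => (i < j)%N)) /=; congr (_ + _)%N.
rewrite (bigD1 i) ?ltnn //= fi add0n; apply: eq_bigl => j.
by rewrite -leqNgt ltn_neqAle andbC.
Qed.

Lemma odd_sum_sym k (e : 'I_k -> 'I_k -> bool) :
  (forall i j, e i j = e j i) -> (forall i, e i i = false) ->
  odd (\sum_(i < k) \sum_(j < k) e i j) = false.
Proof.
move=> es ei; rewrite sum_pairs => [|i]; last by rewrite ei.
under eq_bigr => i _ do under eq_bigr => j _ do rewrite (es j i) addnn -mul2n.
under eq_bigr => i _ do rewrite -big_distrr.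
by rewrite -big_distrr /= oddM.
Qed.

Definition inversions k (x y : 'I_k -> int) (s : 'S_k) : nat :=
  \sum_(j < k) \sum_(i < k) ((x i < x j)%R && (y (s j) < y (s i))%R).

Lemma sign_inversions k (x y : 'I_k -> int) : injective x -> injective y ->
  exists e : bool, forall s : 'S_k, odd_perm s = e (+) odd (inversions x y s).
Proof.
move=> xI yI.
pose V (z : 'I_k -> int) := \prod_(i < k) \prod_(j < k | (i < j)%N) (z j - z i).
have Vdet z : V z = \det (Vandermonde k (\row_j z j)).
  by rewrite det_Vandermonde; apply: eq_bigr => i _; apply: eq_bigr => j _; rewrite !mxE.
have Vperm z (s : 'S_k) : V (z \o s) = (-1) ^+ s * V z.
  rewrite !Vdet.
  have -> : Vandermonde k (\row_j (z \o s) j) = col_perm s (Vandermonde k (\row_j z j)).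
    by apply/matrixP => i j; rewrite !mxE.
  by rewrite col_permE det_mulmx det_perm odd_permV mulrC.
have V0 z : injective z -> V z != 0.
  move=> zI; apply/prodf_neq0 => i _; apply/prodf_neq0 => j lt.
  by rewrite subr_eq0 (inj_eq zI); apply: contraTneq lt => ->; rewrite ltnn.
have key (s : 'S_k) : (-1) ^+ s * Num.sg (V x * V y) = (-1) ^+ inversions x y s :> int.
  rewrite -[LHS](_ : Num.sg (V x * V (y \o s)) = _); last first.
    by rewrite Vperm mulrCA sgrM sgrX sgrN1.
  rewrite /V -big_split /= /inversions exchange_big /= sum_pairs => [|i]; last by rewrite ltxx.
  rewrite (big_morph _ (@sgrM _) (sgr1 _)) (big_morph _ (exprD (-1 : int)) (expr0 _)).
  apply: eq_bigr => i _.
  rewrite -big_split (big_morph _ (@sgrM _) (sgr1 _)) (big_morph _ (exprD (-1 : int)) (expr0 _)).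
  apply: eq_bigr => j lt.
  have ne : j != i by apply: contraTneq lt => ->; rewrite ltnn.
  have nx : x j - x i != 0 by rewrite subr_eq0 (inj_eq xI).
  have ny : y (s j) - y (s i) != 0 by rewrite subr_eq0 (inj_eq yI) (inj_eq perm_inj).
  rewrite /= sgrM -!neqr0_sign // !subr_lt0; move: nx ny; rewrite !subr_eq0.
  by case: (ltgtP (x i) (x j)); case: (ltgtP (y (s i)) (y (s j))).
exists (V x * V y < 0) => s; have := key s.
have := V0 _ xI; have := V0 _ yI => h1 h2.
rewrite -(neqr0_sign (mulf_neq0 h2 h1)) -[in RHS]signr_odd.
by case: (odd_perm s); case: (odd _); case: (_ < 0).
Qed.

Definition lexkey (M : nat) (p : int * int) : int := p.1 * (2 * M + 1)%:Z + p.2.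

Lemma lexkey_lt M p q : `|p.2| <= M%:Z -> `|q.2| <= M%:Z ->
  (lexkey M p < lexkey M q) = (p.1 < q.1) || (p.1 == q.1) && (p.2 < q.2).
Proof.
case: p q => [a b] [c d]; rewrite /lexkey /= => hb hd.
have [lt|gt|->] := ltgtP a c; last by rewrite /= ltrD2l.
- have : (a + 1) * (2 * M + 1)%:Z <= c * (2 * M + 1)%:Z by rewrite ler_wpM2r //; lia.
  by rewrite mulrDl; lia.
- have : (c + 1) * (2 * M + 1)%:Z <= a * (2 * M + 1)%:Z by rewrite ler_wpM2r //; lia.
  by rewrite mulrDl; lia.
Qed.

Section Matchings.
Variables (k : nat) (rs ls : seq (int * int)).
Hypotheses (sr : size rs = k) (sl : size ls = k).

Let r (i : 'I_k) : int * int := nth 0 rs i.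
Let l (i : 'I_k) : int * int := nth 0 ls i.

Definition matching (s : 'S_k) : bool := [forall i, nth 0 ls (s i) \in nbrs (nth 0 rs i)].

(* The rhombus covering rs_i crosses a vertical lattice line. *)
Definition mover (s : 'S_k) (i : 'I_k) : bool := (nth 0 ls (s i)).1 != (nth 0 rs i).1.

Lemma matchingP s : matching s -> forall i,
  if mover s i then (l (s i)).1 = (r i).1 - 1 /\ (l (s i)).2 = (r i).2
  else (l (s i)).1 = (r i).1 /\ ((l (s i)).2 = (r i).2 \/ (l (s i)).2 = (r i).2 - 1).
Proof.
move=> /forallP h i; have := h i; rewrite /mover -/(r i) -/(l (s i)).
case: (r i) => a b; case: (l (s i)) => c d; rewrite /nbrs !inE !xpair_eqE /= => h1.
by case: eqP => h2 /=; clear -h1 h2; lia.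
Qed.

Lemma sum_count (P : pred (int * int)) : (\sum_(i < k) P (r i) = count P rs)%N.
Proof.
by rewrite -sum1_count [RHS]big_mkcond [RHS](big_nth 0) sr big_mkord; apply: eq_bigr => i _; case: (P _).
Qed.

Lemma sum_count_perm (s : 'S_k) (P : pred (int * int)) : (\sum_(i < k) P (l (s i)) = count P ls)%N.
Proof.
rewrite -sum1_count [RHS]big_mkcond [RHS](big_nth 0) sl big_mkord [RHS](reindex_inj (@perm_inj _ s)).
by apply: eq_bigr => i _; rewrite /l; case: (P _).
Qed.

(* An inversion consists of a mover j and a non-mover i; [rho] also counts the
   movers i of the column of j, whose total contribution is even. *)
Definition rho (p : int * int) : nat :=
  count (fun q => (q.1 == p.1) && (q.2 < p.2)%R) rs +
  count (fun q => (q.1 == p.1 - 1)%R && (p.2 < q.2)%R) ls.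

Lemma odd_inversions M s : (forall p, p \in rs ++ ls -> `|p.2| <= M%:Z) -> matching s ->
  odd (inversions (lexkey M \o r) (lexkey M \o l) s) = odd (\sum_j mover s j * rho (r j)).
Proof.
move=> hM ms.
have Mr i : `|(r i).2| <= M%:Z by apply: hM; rewrite mem_cat mem_nth ?sr.
have Ml i : `|(l i).2| <= M%:Z by apply: hM; rewrite mem_cat orbC mem_nth ?sl.
pose e i j := [&& mover s j, mover s i, (r i).1 == (r j).1 & (r i).2 != (r j).2].
have -> : (\sum_j mover s j * rho (r j) =
   inversions (lexkey M \o r) (lexkey M \o l) s + \sum_j \sum_i e j i)%N.
  rewrite -big_split; apply: eq_bigr => j _ /=.
  rewrite /rho -sum_count -(sum_count_perm s) -!big_split big_distrr /=; apply: eq_bigr => i _ /=.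
  rewrite !lexkey_lt // /e.
  have := matchingP ms i; have := matchingP ms j.
  case: (r i) (r j) (l (s i)) (l (s j)) => a b [c d] [a' b'] [c' d'] /=.
  case: (mover s i); case: (mover s j) => /= hj hi; lia.
have h : odd (\sum_j \sum_i e j i) = false.
  apply: odd_sum_sym => [i j|i]; rewrite /e ?eqxx ?andbF //.
  by rewrite eq_sym [_ == (r j).2]eq_sym; case: (mover s i); case: (mover s j).
by rewrite oddD h addbF.
Qed.

Definition movers_above s (a x : int) : nat :=
  \sum_j [&& mover s j, (r j).1 == a & (x <= (r j).2)%R].

(* Non-movers of column a cannot cross the height x next to a missing triangle. *)
Lemma movers_cut s a x : matching s -> ((a, x) \notin rs) || ((a, x - 1) \notin ls) ->
  (count (fun q => (q.1 == a) && (x <= q.2)%R) rs + movers_above s (a + 1) x =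
   count (fun q => (q.1 == a) && (x <= q.2)%R) ls + movers_above s a x)%N.
Proof.
move=> ms clean; rewrite -sum_count -(sum_count_perm s) /movers_above -!big_split /=.
apply: eq_bigr => i _.
have ri : r i \in rs by rewrite mem_nth ?sr.
have li : l (s i) \in ls by rewrite mem_nth ?sl.
have hc : (r i != (a, x)) || (l (s i) != (a, x - 1)).
  by case/orP: clean => c; apply/orP; [left|right]; apply: contraNneq c => <-.
have := matchingP ms i; case: (r i) (l (s i)) hc {ri li clean} => b c [b' c'].
by rewrite !xpair_eqE; case: (mover s i) => /= hc h; lia.
Qed.
End Matchings.

Lemma norm_det_adjmx k (rs ls : seq (int * int)) :
  (forall s t : 'S_k, matching rs ls s -> matching rs ls t -> odd_perm s = odd_perm t) ->
  `|\det (adjmx k rs ls)| = #|[set s : 'S_k | matching rs ls s]|%:R.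
Proof.
move=> hs; rewrite /determinant.
have -> : \sum_(s : 'S_k) (-1) ^+ s * \prod_i adjmx k rs ls i (s i) =
    \sum_(s in [set s : 'S_k | matching rs ls s]) (-1) ^+ s.
  rewrite [RHS]big_mkcond; apply: eq_bigr => s _; rewrite inE.
  case: (boolP (matching rs ls s)) => [/forallP h|].
    by rewrite big1 ?mulr1 // => i _; rewrite mxE h.
  rewrite negb_forall => /existsP[i h]; apply/eqP; rewrite mulf_eq0; apply/orP; right.
  by apply/prodf_eq0; exists i => //; rewrite mxE (negPf h).
have [->|[s0 h0]] := set_0Vmem [set s : 'S_k | matching rs ls s].
  by rewrite big_set0 cards0 normr0.
rewrite (eq_bigr (fun=> (-1) ^+ s0)) => [|s h]; last first.
  by rewrite !inE in h0 h; rewrite (hs s s0).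
by rewrite sumr_const normrMn normrX normrN1 expr1n.
Qed.

Lemma count_split3 (T : Type) (P P1 P2 P3 : pred T) (s : seq T) :
  (forall q, (P1 q + P2 q + P3 q)%N = P q) -> (count P1 s + count P2 s + count P3 s = count P s)%N.
Proof. by move=> h; elim: s => //= q s <-; rewrite -h; lia. Qed.

Lemma count_hex n N p : p \in hexR n N -> 0 < p.1 ->
  (count (fun q => (q.1 == p.1) && (q.2 < p.2)%R) (hexR n N) +
   count (fun q => (q.1 == p.1 - 1)%R && (p.2 < q.2)%R) (hexL n N) + 1 =
   count (fun q => q.1 == p.1) (hexR n N))%N.
Proof.
move=> pR p1.
have -> : count (fun q => (q.1 == p.1 - 1)%R && (p.2 < q.2)%R) (hexL n N) =
    count (fun q => (q.1 == p.1) && (p.2 < q.2)%R) (hexR n N).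
  have inj : injective (fun q : int * int => (q.1 - 1, q.2)).
    by case=> [a b] [c d] [/eqP e1 e2]; congr pair => //; rewrite /= in e1; lia.
  rewrite -!size_filter -[RHS](size_map (fun q : int * int => (q.1 - 1, q.2))).
  apply/perm_size/uniq_perm; rewrite ?(map_inj_uniq inj) ?filter_uniq ?fset_uniq //.
  have mR q : (q \in enum_fset (hexR n N)) = (q \in hexR n N) by [].
  have mL q : (q \in enum_fset (hexL n N)) = (q \in hexL n N) by [].
  move: pR; case: p p1 => a b /= a0; rewrite mem_hexR /= => h [c d].
  rewrite mem_filter mL mem_hexL /=; apply/idP/mapP => [h1|[[c' d']]].
    exists (c + 1, d); rewrite /= ?addrK // mem_filter mR mem_hexR /=; clear mR mL inj; lia.
  by rewrite mem_filter mR mem_hexR /= => h1 [-> ->]; clear mR mL inj; lia.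
have -> : 1%N = count (pred1 p) (hexR n N) by rewrite count_uniq_mem ?fset_uniq ?pR.
by apply: count_split3 => q; case: p q {pR p1} => a b [c d] /=; rewrite xpair_eqE; lia.
Qed.

Section Hole.
Variables (n N a0 : nat) (b0 : int).
Hypothesis r0H : (a0%:Z, b0) \in hexR n N.
Hypothesis l0H : (a0.+1%:Z, b0 - 1) \in hexL n N.
Let R := (hexR n N `\ (a0%:Z, b0))%fset.
Let L := (hexL n N `\ (a0.+1%:Z, b0 - 1))%fset.
Let k := #|` R|.

Lemma card_hole : #|` R| = #|` L|.
Proof.
have := card_hexLR n N; rewrite (cardfsD1 (a0%:Z, b0) (hexR n N)) r0H.
by rewrite (cardfsD1 (a0.+1%:Z, b0 - 1) (hexL n N)) l0H => /addnI.
Qed.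

Let szL : size L = k. Proof. by rewrite /k card_hole. Qed.

Let r (i : 'I_k) : int * int := nth 0 R i.

Let rR i : r i \in R. Proof. by apply: mem_nth. Qed.

Let inR p : (p \in enum_fset R) = (p != (a0%:Z, b0)) && (p \in hexR n N).
Proof. by rewrite -in_fsetD1. Qed.

Let inL p : (p \in enum_fset L) = (p != (a0.+1%:Z, b0 - 1)) && (p \in hexL n N).
Proof. by rewrite -in_fsetD1. Qed.

Lemma mover_left (s : 'S_k) i : matching R L s -> mover R L s i ->
  ((r i).1 - 1, (r i).2) \in L.
Proof.
move=> ms mi; have := matchingP ms i; rewrite mi -/(r i) => -[<- <-].
by rewrite -surjective_pairing; apply: mem_nth; rewrite szL.
Qed.

Let x0 : int := - n%:Z - 1.

Lemma movers_total (s t : 'S_k) (a : nat) : matching R L s -> matching R L t ->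
  movers_above R L s a%:Z x0 = movers_above R L t a%:Z x0.
Proof.
move=> ms mt; elim: a => [|a IH].
  suff h (u : 'S_k) : matching R L u -> movers_above R L u 0 x0 = 0%N by rewrite !h.
  move=> mu; rewrite /movers_above big1 // => i _; apply/eqP; rewrite eqb0.
  apply/negP => /and3P[mi /eqP e _]; have := mover_left mu mi.
  by rewrite -/(r i) in e; rewrite inL mem_hexL /= e => /andP[_]; lia.
have clean : ((a%:Z, x0) \notin enum_fset R) || ((a%:Z, x0 - 1) \notin enum_fset L).
  by rewrite inR mem_hexR /= /x0 -implybE; apply/implyP; lia.
have := movers_cut (erefl k) szL ms clean; have := movers_cut (erefl k) szL mt clean.
have -> : a%:Z + 1 = a.+1%:Z by lia.
by rewrite IH => <- /addnI.
Qed.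

Lemma movers_column_sum (s t : 'S_k) (g : int -> nat) : matching R L s -> matching R L t ->
  (\sum_i mover R L s i * g (r i).1 = \sum_i mover R L t i * g (r i).1)%N.
Proof.
move=> ms mt.
have h (u : 'S_k) : (\sum_i mover R L u i * g (r i).1 =
    \sum_(a < 2 * n) g a%:Z * movers_above R L u a%:Z x0)%N.
  rewrite /movers_above; under [RHS]eq_bigr => a _ do rewrite big_distrr.
  rewrite exchange_big; apply: eq_bigr => i _ /=; rewrite -/(r i).
  have := rR i; rewrite -[_ \in R]/(_ \in enum_fset R) inR mem_hexR => /and4P[_ h1 h2 _].
  have [h3 h4 h5] : [/\ (absz (r i).1 < 2 * n)%N, (absz (r i).1)%:Z = (r i).1 & - n%:Z - 1 <= (r i).2].
    by case: (r i) h1 h2 => a b /=; clear; split; lia.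
  rewrite (bigD1 (Ordinal h3)) //= big1 => [|a ne].
    by rewrite h4 h5 eqxx !andbT addn0 mulnC.
  suff /negPf -> : (r i).1 != a%:Z by rewrite andbF muln0.
  by apply: contraNneq ne => e; apply/eqP/val_inj => /=; rewrite e.
by rewrite !h; apply: eq_bigr => a _; rewrite (movers_total a ms mt).
Qed.

Lemma rho_hole p : p \in R -> (p.1 - 1, p.2) \in L ->
  (rho R L p + ((p.1 == a0%:Z) && (b0 <= p.2)%R) + (p.1 == (a0 + 2)%N%:Z) + 1 =
  count (fun q => q.1 == p.1) (hexR n N) + ((p.1 == (a0 + 2)%N%:Z) && (b0 <= p.2)%R))%N.
Proof.
rewrite -![_ \in _]/(_ \in enum_fset _) inR inL => /andP[n1 hR] /andP[n2 hL].
have p1 : 0 < p.1 by move: hL; rewrite mem_hexL /=; lia.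
rewrite -(count_hex hR p1).
have e1 := seq.permP (perm_fset1 r0H) (fun q => (q.1 == p.1) && (q.2 < p.2)%R).
have e2 := seq.permP (perm_fset1 l0H) (fun q => (q.1 == p.1 - 1)%R && (p.2 < q.2)%R).
rewrite -{}e1 -{}e2 /rho -/R -/L; move: n1 n2; case: p {hR hL p1} => a b /=.
move: (count _ R) (count _ L) => c1 c2; rewrite !xpair_eqE /= => n1 n2.
move: n1 n2; clear; lia.
Qed.

Lemma matching_parity (s t : 'S_k) : matching R L s -> matching R L t ->
  odd_perm s = odd_perm t.
Proof.
move=> ms mt.
have cut1 : ((a0%:Z, b0) \notin enum_fset R) || ((a0%:Z, b0 - 1) \notin enum_fset L).
  by rewrite inR eqxx.
have cut2 : ((a0%:Z + 1, b0) \notin enum_fset R) || ((a0%:Z + 1, b0 - 1) \notin enum_fset L).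
  by rewrite inL !xpair_eqE eqxx orbC; have -> : a0%:Z + 1 == a0.+1%:Z by lia.
have sum (u : 'S_k) : matching R L u ->
  (\sum_j mover R L u j * rho R L (r j) + movers_above R L u a0%:Z b0 +
    \sum_j mover R L u j * ((r j).1 == (a0 + 2)%N%:Z).+1 =
   \sum_j mover R L u j * count (fun q => q.1 == (r j).1) (hexR n N) +
   movers_above R L u (a0 + 2)%N%:Z b0)%N.
  move=> mu; rewrite /movers_above -!big_split; apply: eq_bigr => j _ /=.
  case: (boolP (mover R L u j)) => // mj; rewrite !mul1n.
  have := rho_hole (rR j) (mover_left mu mj); rewrite -/(r j) => <-.
  by rewrite addn1 addnS.
have e : (\sum_j mover R L s j * rho R L (r j) = \sum_j mover R L t j * rho R L (r j))%N.
  have := sum _ ms; have := sum _ mt.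
  rewrite (movers_column_sum (fun a => (a == (a0 + 2)%N%:Z).+1) ms mt).
  rewrite (movers_column_sum (fun a => count (fun q => q.1 == a) (hexR n N)) ms mt).
  have := movers_cut (erefl k) szL ms cut1; have := movers_cut (erefl k) szL ms cut2.
  have := movers_cut (erefl k) szL mt cut1; have := movers_cut (erefl k) szL mt cut2.
  have -> : a0%:Z + 1 + 1 = (a0 + 2)%N%:Z by lia.
  clear; lia.
pose M := (n + N)%N.
have hM p : p \in enum_fset R ++ enum_fset L -> `|p.2| <= M%:Z.
  rewrite mem_cat inR inL mem_hexR mem_hexL /M; clear; case: p => a b /=; lia.
have kI (T : seq (int * int)) : uniq T -> size T = k -> (forall p, p \in T -> `|p.2| <= M%:Z) ->
    injective (lexkey M \o (fun i : 'I_k => nth 0 T i)).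
  move=> uT sT hT i j /= e1; apply/val_inj/eqP; rewrite -(nth_uniq 0 _ _ uT) ?sT ?ltn_ord //.
  have h1 : `|(nth 0 T i).2| <= M%:Z by apply: hT; rewrite mem_nth ?sT.
  have h2 : `|(nth 0 T j).2| <= M%:Z by apply: hT; rewrite mem_nth ?sT.
  have := lexkey_lt h1 h2; have := lexkey_lt h2 h1; rewrite e1 ltxx.
  by case: (nth 0 T i) (nth 0 T j) => a b [c d] /=; rewrite xpair_eqE; clear; lia.
have IR : injective (lexkey M \o (fun i : 'I_k => nth 0 R i)).
  by apply: kI; rewrite ?fset_uniq // => p hp; apply: hM; rewrite mem_cat hp.
have IL : injective (lexkey M \o (fun i : 'I_k => nth 0 L i)).
  by apply: kI; rewrite ?fset_uniq // => p hp; apply: hM; rewrite mem_cat hp orbT.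
have [e0 h] := sign_inversions IR IL.
rewrite !h; congr addb.
rewrite (odd_inversions (erefl k) szL hM ms) (odd_inversions (erefl k) szL hM mt).
by rewrite e.
Qed.
End Hole.

(** * Tilings as matchings *)

Ltac decide_eqs := repeat match goal with |- context [?x == ?y] =>
  first [rewrite (_ : (x == y) = true); [|lia] | rewrite (_ : (x == y) = false); [|lia]] end.

Lemma uniq_vertices t : uniq (vertices t).
Proof. by case: t => [[a b] []]; rewrite /= !inE !xpair_eqE; decide_eqs. Qed.

Lemma share_side2 t u : share_side t u -> exists v w,
  [/\ v \in vertices t, w \in vertices t, v != w, v \in vertices u & w \in vertices u].
Proof.
rewrite /share_side; case e: [seq v <- vertices t | v \in vertices u] => [|v [|w []]] // _.
have mem x : x \in [:: v; w] -> (x \in vertices t) && (x \in vertices u).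
  by rewrite -e mem_filter andbC.
have vw : v != w.
  have : uniq [:: v; w].
    by rewrite -e filter_uniq ?uniq_vertices.
  by rewrite /= inE andbT.
have /andP[h1 h2] := mem v (mem_head _ _).
have /andP[h3 h4] := mem w (mem_last v [:: w]).
by exists v, w; split.
Qed.

Lemma share_side_opposite p q : share_side (p, false) (q, true) = (q \in nbrs p).
Proof.
case: p q => a b [c d]; apply/idP/idP => [/share_side2[v [w []]]|].
  rewrite /= !inE => /or3P[]/eqP-> /or3P[]/eqP->; rewrite ?eqxx // !xpair_eqE /= => _ h1 h2; lia.
rewrite !inE => /or3P[]/eqP[-> ->]; rewrite /share_side size_filter /= !inE !xpair_eqE;
  decide_eqs; by [].
Qed.

Lemma share_sideC t u : share_side t u = share_side u t.
Proof.
have key (s s' : seq (int * int)) : uniq s -> uniq s' ->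
    size [seq v <- s | v \in s'] = size [seq v <- s' | v \in s].
  move=> us us'; apply/perm_size/uniq_perm; rewrite ?filter_uniq // => v.
  by rewrite !mem_filter andbC.
by rewrite /share_side key ?uniq_vertices.
Qed.

Lemma share_side_same p q d : share_side (p, d) (q, d) = false.
Proof.
have irr t : share_side t t = false.
  case: t => [[a b] []]; rewrite /share_side size_filter /= !inE !xpair_eqE; decide_eqs; by [].
apply/negP => h; have := h; case/share_side2 => v [w []].
suff : forall v w, v \in vertices (p, d) -> w \in vertices (p, d) -> v != w ->
    v \in vertices (q, d) -> w \in vertices (q, d) -> p = q.
  by move=> H h1 h2 h3 h4 h5; move: h; rewrite (H v w h1 h2 h3 h4 h5) irr.
case: p q d {h} => a b [c e] [] {}v {}w; rewrite /= !inE => /or3P[]/eqP-> /or3P[]/eqP->;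
  rewrite ?eqxx // !xpair_eqE => _ h1 h2; congr pair; lia.
Qed.

Section Tilings.
Variables (D : {fset (int * int) * bool}) (k : nat) (rs ls : seq (int * int)).
Hypotheses (sr : size rs = k) (sl : size ls = k) (ur : uniq rs) (ul : uniq ls).
Hypotheses (Dr : forall p, ((p, false) \in D) = (p \in rs)).
Hypotheses (Dl : forall p, ((p, true) \in D) = (p \in ls)).

Let rs_in (i : 'I_k) : (nth 0 rs i, false) \in D.
Proof. by rewrite Dr mem_nth ?sr. Qed.
Let ls_in (i : 'I_k) : (nth 0 ls i, true) \in D.
Proof. by rewrite Dl mem_nth ?sl. Qed.
Let RD (i : 'I_k) : D := [` rs_in i]%fset.
Let LD (i : 'I_k) : D := [` ls_in i]%fset.

Let RDI : injective RD.
Proof.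
move=> i j /(congr1 val)[/eqP]; rewrite nth_uniq ?sr // => /eqP; exact: val_inj.
Qed.
Let LDI : injective LD.
Proof.
move=> i j /(congr1 val)[/eqP]; rewrite nth_uniq ?sl // => /eqP; exact: val_inj.
Qed.
Let RLD i j : RD i <> LD j. Proof. by move/(congr1 val). Qed.

Let D_cases (x : D) : (exists i, x = RD i) \/ (exists i, x = LD i).
Proof.
case: x => [[p d] h]; have := h; case: d h => h; [rewrite Dl|rewrite Dr].
  move=> hp; right; have lt : (index p ls < k)%N by rewrite -sl index_mem.
  by exists (Ordinal lt); apply/val_inj; rewrite /= nth_index.
move=> hp; left; have lt : (index p rs < k)%N by rewrite -sr index_mem.
by exists (Ordinal lt); apply/val_inj; rewrite /= nth_index.
Qed.

Let block i j : {set D} := [set RD i; LD j].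

Let blockP i j i' j' x : x \in block i j -> x \in block i' j' -> i = i' \/ j = j'.
Proof.
rewrite !inE => /orP[]/eqP-> /orP[]/eqP.
- by move/RDI; left.
- by move/RLD.
- by move/esym/RLD.
- by move/LDI; right.
Qed.

Let rhombus_block (B : {set D}) :
  is_rhombus B -> exists i j, B = block i j /\ nth 0 ls j \in nbrs (nth 0 rs i).
Proof.
case/existsP => t /existsP[u /andP[/eqP -> h]].
have [[i et]|[i et]] := D_cases t; have [[j eu]|[j eu]] := D_cases u; subst t u.
- by rewrite share_side_same in h.
- by exists i, j; rewrite share_side_opposite in h.
- by exists j, i; rewrite /block setUC; rewrite share_sideC share_side_opposite in h.
- by rewrite share_side_same in h.
Qed.

Let block_rhombus (i j : 'I_k) : nth 0 ls j \in nbrs (nth 0 rs i) -> is_rhombus (block i j).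
Proof.
move=> h; apply/existsP; exists (RD i); apply/existsP; exists (LD j).
by rewrite eqxx share_side_opposite.
Qed.

Let tiling (s : 'S_k) : {set {set D}} := [set block i (s i) | i : 'I_k].

Let tilingI : injective tiling.
Proof.
move=> s t e; apply/permP => i.
have : block i (s i) \in tiling t by rewrite -e; apply: imset_f.
case/imsetP => j _ /setP eB.
have := eB (RD i); rewrite !inE eqxx /= => /esym/orP[]/eqP; last by move/RLD.
move/RDI => ij; subst j; have := eB (LD (s i)); rewrite !inE eqxx orbT => /esym/orP[]/eqP.
  by move/esym/RLD.
exact: LDI.
Qed.

Lemma card_rhombus_tilings : #|rhombus_tilings D| = #|[set s : 'S_k | matching rs ls s]|.
Proof.
rewrite -(card_imset _ tilingI); apply: eq_card => T; apply/idP/imsetP.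
  rewrite inE => /andP[/and3P[/eqP cT tT _] /forallP rT].
  have rT' B : B \in T -> is_rhombus B by move=> hB; have := rT B; rewrite hB.
  have ex (i : 'I_k) : exists j : 'I_k,
      (block i j \in T) && (nth 0 ls j \in nbrs (nth 0 rs i)).
    have : RD i \in cover T by rewrite cT inE.
    case/bigcupP => B BT; have [i' [j [eB hij]]] := rhombus_block (rT' B BT); subst B.
    rewrite !inE => /orP[]/eqP; last by move/RLD.
    by move/RDI => ii; subst i'; exists j; rewrite BT hij.
  have [f hf] := fin_all_exists ex.
  have same A B x : A \in T -> B \in T -> x \in A -> x \in B -> A = B.
    by move=> AT BT xA xB; rewrite -(def_pblock tT AT xA) (def_pblock tT BT xB).
  have fI : injective f.
    move=> i i' e; have /andP[h1 _] := hf i; have /andP[h2 _] := hf i'.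
    have /setP /(_ (RD i)) : block i (f i) = block i' (f i').
      by apply: (same _ _ (LD (f i))) => //; rewrite !inE ?e eqxx orbT.
    by rewrite !inE eqxx /= => /esym/orP[]/eqP; [move/RDI | move/RLD].
  exists (perm fI).
    by rewrite inE; apply/forallP => i; rewrite permE; case/andP: (hf i).
  apply/setP => B; apply/idP/imsetP => [BT|[i _ ->]]; last by rewrite permE; case/andP: (hf i).
  have [i [j [eB hij]]] := rhombus_block (rT' B BT); exists i => //; rewrite permE.
  have /andP[h1 _] := hf i; apply: (same _ _ (RD i)) => //.
    by rewrite eB !inE eqxx.
  by rewrite !inE eqxx.
case=> s; rewrite inE => /forallP ms ->; rewrite inE; apply/andP; split; last first.
  by apply/forallP => B; apply/implyP => /imsetP[i _ ->]; apply: block_rhombus.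
apply/and3P; split.
- apply/eqP/setP => x; rewrite [RHS]inE; apply/bigcupP.
  have [[i ->]|[j ->]] := D_cases x.
    by exists (block i (s i)); [apply: imset_f | rewrite !inE eqxx].
  exists (block (s^-1%g j) (s (s^-1%g j))); first exact: imset_f.
  by rewrite permKV !inE eqxx orbT.
- apply/trivIsetP => A B /imsetP[i _ ->] /imsetP[j _ ->] ne.
  rewrite -setI_eq0; apply/eqP/setP => x; rewrite [RHS]inE; apply/negP => /setIP[h1 h2].
  by case/eqP: ne; have [->|/perm_inj ->] := blockP h1 h2.
- by apply/imsetP => -[i _ /setP /(_ (RD i))]; rewrite !inE eqxx.
Qed.
End Tilings.

(** * The holed hexagon *)

Lemma iter_cdiff_shift a F (c k : int) :
  iter a cdiff (fun j => F (j + c)) k = iter a cdiff F (k + c).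
Proof.
elim: a k => //= a IH k; rewrite /cdiff !IH.
by rewrite [k + 1 + c]addrAC [k - 1 + c]addrAC.
Qed.

Lemma mem_holed_hexagon n m s t :
  (t \in holed_hexagon n m s) = (t \in hexagon n m) && ~~ removed m s t.
Proof. by rewrite !inE. Qed.

Lemma holed_hexagon_false n m a p :
  ((p, false) \in holed_hexagon n m a.+1) =
  (p \in hexR n (2 * m + 1) `\ ((2 * a)%N%:Z, m%:Z - a%:Z))%fset.
Proof.
rewrite in_fsetD1 mem_hexR mem_holed_hexagon in_hexagon removedE !inE; case: p => c d.
rewrite /vertices /in_H /= !xpair_eqE /=; lia.
Qed.

Lemma holed_hexagon_true n m a p :
  ((p, true) \in holed_hexagon n m a.+1) =
  (p \in hexL n (2 * m + 1) `\ ((2 * a).+1%:Z, m%:Z - a%:Z - 1))%fset.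
Proof.
rewrite in_fsetD1 mem_hexL mem_holed_hexagon in_hexagon removedE !inE; case: p => c d.
rewrite /vertices /in_H /= !xpair_eqE /=; lia.
Qed.

Theorem theorem2 (n m s : nat) (hn : (1 <= n)%N) (hs : (1 <= s <= n)%N) :
  #|rhombus_tilings (holed_hexagon n m s)|%:R =
    (2 * m + 1)%:R * 'C(2 * m, m)%:R * 'C(2 * n - 2 * s, n - s)%:R
      * 'C(2 * s - 2, s - 1)%:R / 'C(2 * m + 2 * n, m + n)%:R
    * \prod_(1 <= i < n.+1) \prod_(1 <= j < n.+1) \prod_(1 <= k < (2 * m + 1).+1)
        (((i + j + k)%:R - 1) / ((i + j + k)%:R - 2)) :> rat.
Proof.
case: s hs => // a hs; pose b := (n - a.+1)%N.
have en : n = (a + b).+1 by rewrite /b; lia.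
set N := (2 * m + 1)%N; pose b0 : int := m%:Z - a%:Z.
have r0H : ((2 * a)%N%:Z, b0) \in hexR n N by rewrite mem_hexR /N /b0 /=; clear -hs; lia.
have l0H : ((2 * a).+1%:Z, b0 - 1) \in hexL n N by rewrite mem_hexL /N /b0 /=; clear -hs; lia.
rewrite (@card_rhombus_tilings _ _ (hexR n N `\ ((2 * a)%N%:Z, b0))%fset
   (hexL n N `\ ((2 * a).+1%:Z, b0 - 1))%fset (erefl _)
   (esym (card_hole r0H l0H)) (fset_uniq _) (fset_uniq _)
   (holed_hexagon_false n m a) (holed_hexagon_true n m a)).
rewrite -norm_det_adjmx; last by move=> s t; apply: matching_parity.
have [Y [suppY _ eqY valY]] := axis_solution a b m.
pose y (j : int) := Y (j + (n%:Z - m%:Z)).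
have := @ndet_remove n N (2 * a) (2 * a).+1 b0 (b0 - 1) y r0H l0H (leqnSn _).
rewrite /ndet => -> ; first last.
- move=> j hj.
  have -> : j = j - n%:Z + n%:Z by lia.
  rewrite iter_bdiff_even iter_cdiff_shift.
  have -> : j - n%:Z + n%:Z = j - a%:Z + a%:Z by lia.
  rewrite iter_bdiff_even [in LHS]en.
  rewrite (eq_iter_cdiff a (G := fun i => kdelta 0 (i + - b0))); last first.
    by move=> i; rewrite /kdelta subr_eq0.
  rewrite iter_cdiff_shift eqY; last by move: hj; rewrite /N; clear; lia.
  by congr (iter _ _ _ _); rewrite /b0; clear; lia.
- by move=> j hj; apply: suppY; move: hj; rewrite /N; clear; lia.
rewrite -/(ndet _ _) ndet_hex // mulrC; congr (_ * _).
have -> : (2 * n - (2 * a).+2 = 2 * b)%N by lia.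
have -> : b0 - 1 = b0 - 1 - b%:Z + b%:Z by clear; lia.
rewrite iter_bdiff_even iter_cdiff_shift.
have -> : b0 - 1 - b%:Z + (n%:Z - m%:Z) = 0 by rewrite /b0 en; clear; lia.
rewrite valY normrN ger0_norm; last by rewrite !(mulr_ge0, invr_ge0) ?ler0n.
have -> : (2 * n - 2 * a.+1 = 2 * b)%N by lia.
have -> : (2 * a.+1 - 2 = 2 * a)%N by clear; lia.
have -> : (2 * m + 2 * n = 2 * (m + (a + b).+1))%N by rewrite en; clear; lia.
rewrite -[(n - a.+1)%N]/b -en subn1 /=.
by congr (_ / _); exact: mulrAC.
Qed.
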